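(* Let $F=\frac1n\sum_{i=1}^nF_i$. Assume that there is $\widehat\ell>0$ such that for all $x\in\mathbb{R}^d$, with $x^*=\mathrm{proj}_{X^*}(x)$, $$\frac1n\sum_{i=1}^n\|F_i(x)-F_i(x^* )\|^2\le\widehat\ell\,\langle F(x)-F(x^* ),x-x^*\rangle,$$ that $X^*=\{x^*\}$ is a singleton, and that for all $i\in\{1,\dots,n\}$, $k\ge0$, $\mathbb{E}_k[g_i^k]=F_i(x^k)$ and $\mathbb{E}_k\|g_i^k-F_i(x^k)\|^2\le\sigma_i^2$. Suppose that $0<\alpha\le\frac{1}{1+\omega}$. Then DIANA-SGDA satisfies the key parametric assumption with $\sigma_k^2=\frac1n\sum_{i=1}^n\|h_i^k-F_i(x^* )\|^2$ and $$A=\left(\frac12+\frac\omega n\right)\widehat\ell,\quad B=\frac{2\omega}{n},\quad D_1=\frac{(1+\omega)\sigma^2}{n},\quad C=\frac{\alpha\widehat\ell}{2},\quad\rho=\alpha,\quad D_2=\alpha\sigma^2,$$ where $\sigma^2=\frac1n\sum_{i=1}^n\sigma_i^2$.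
   Context: Norms and inner products on $\mathbb{R}^d$ are Euclidean. $F,F_1,\dots,F_n:\mathbb{R}^d\to\mathbb{R}^d$ are operators and $R:\mathbb{R}^d\to\mathbb{R}\cup\{+\infty\}$ is a proper lower semicontinuous convex function. $X^*$ is the (nonempty) set of solutions of the regularized variational inequality: find $x^*\in\mathbb{R}^d$ with $\langle F(x^* ),x-x^*\rangle+R(x)-R(x^* )\ge0$ for all $x\in\mathbb{R}^d$. $\mathrm{proj}_{X^*}(x)=\arg\min_{y\in X^*}\|y-x\|$. An unbiased compressor (quantization) with parameter $\omega\ge0$ is a possibly randomized map $\mathcal{Q}:\mathbb{R}^d\to\mathbb{R}^d$ with $\mathbb{E}[\mathcal{Q}(x)]=x$ and $\mathbb{E}\|\mathcal{Q}(x)-x\|^2\le\omega\|x\|^2$ for all $x$. DIANA-SGDA, with stepsizes $\gamma,\alpha>0$, such a $\mathcal{Q}$, starting points $x^0,h_1^0,\dots,h_n^0\in\mathbb{R}^d$, $h^0=\frac1n\sum_ih_i^0$: at iteration $k$, each $i=1,\dots,n$ computes a stochastic estimate $g_i^k$ of $F_i(x^k)$ and sets $\Delta_i^k=g_i^k-h_i^k$, $h_i^{k+1}=h_i^k+\alpha\mathcal{Q}(\Delta_i^k)$; then $$g^k=h^k+\frac1n\sum_{i=1}^n\mathcal{Q}(\Delta_i^k),\quad h^{k+1}=h^k+\frac\alpha n\sum_{i=1}^n\mathcal{Q}(\Delta_i^k)=\frac1n\sum_{i=1}^nh_i^{k+1},\quad x^{k+1}=\mathrm{prox}_{\gamma R}(x^k-\gamma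 g^k),$$ where $\mathrm{prox}_{\gamma R}(x)=\arg\min_{y}\{R(y)+\|y-x\|^2/(2\gamma)\}$ and the same realization of $\mathcal{Q}(\Delta_i^k)$ is used in all updates. Given the past, $g_1^k,\dots,g_n^k$ are independent, and given these the compressed vectors $\mathcal{Q}(\Delta_1^k),\dots,\mathcal{Q}(\Delta_n^k)$ are independent. Put $x^{*,k}=\mathrm{proj}_{X^*}(x^k)$ and $g^{*,k}=F(x^{*,k})$. $\mathbb{E}_k[\cdot]$ is the expectation with respect to the randomness at iteration $k$, i.e. conditional on everything generated before iteration $k$ (in particular on $x^k$ and the $h_i^k$). Key parametric assumption (with constants $A,B,C,D_1,D_2\ge0$, $\rho\in(0,1]$ and nonnegative variables $\sigma_k$): for all $k\ge0$, $\mathbb{E}_k[g^k]=F(x^k)$ and $$\mathbb{E}_k\|g^k-g^{*,k}\|^2\le2A\langle F(x^k)-g^{*,k},x^k-x^{*,k}\rangle+B\sigma_k^2+D_1,$$ $$\mathbb{E}_k[\sigma_{k+1}^2]\le2C\langle F(x^k)-g^{*,k},x^k-x^{*,k}\rangle+(1-\rho)\sigma_k^2+D_2.$$ (The variables $\sigma_k$ here are unrelated to the variance bounds $\sigma_i$ of the workers.) *)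

(* Defs.v *)
From HB Require Import structures.
From mathcomp Require Import all_boot all_order all_algebra.
From mathcomp Require Import all_classical all_reals all_analysis.

Set Implicit Arguments.
Unset Strict Implicit.
Unset Printing Implicit Defensive.

Import Order.TTheory GRing.Theory Num.Theory.
Import numFieldNormedType.Exports.

Local Open Scope classical_set_scope.
Local Open Scope ring_scope.

(* Vectors of R^d are row vectors.  The library's norm `|x| on 'rV[R]_d is the
   sup norm, hence the explicit Euclidean structure (the topology is the same). *)
Section Euclidean.
Context {R : realType} {d : nat}.
Implicit Types u v : 'rV[R]_d.

Definition dotp u v : R := \sum_(j < d) u 0 j * v 0 j.

Definition norm2 u : R := Num.sqrt (dotp u u).

End Euclidean.

(* The Borel sigma-algebra of R^d, generated by the coordinate maps exactly as
   the library does for n.-tuple T. *)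
Section measurable_rV.
Context {R : realType} {d : nat}.

Let coord (j : 'I_d) (v : 'rV[R]_d) : measurableTypeR R := v 0 j.

Let rV_set0 : g_sigma_preimage coord set0.
Proof. exact: sigma_algebra0. Qed.

Let rV_setC A : g_sigma_preimage coord A -> g_sigma_preimage coord (~` A).
Proof. exact: sigma_algebraC. Qed.

Let rV_bigcup (A : (set 'rV[R]_d)^nat) :
  (forall i, g_sigma_preimage coord (A i)) ->
  g_sigma_preimage coord (\bigcup_i A i).
Proof. exact: sigma_algebra_bigcup. Qed.

HB.instance Definition _ := @isMeasurable.Build
  default_measure_display 'rV[R]_d (g_sigma_preimage coord)
  rV_set0 rV_setC rV_bigcup.

End measurable_rV.

Section Optimization.
Context {R : realType} {d : nat}.
Implicit Types (r : 'rV[R]_d -> \bar R) (S : set 'rV[R]_d).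

Definition proper_ereal r : Prop :=
  (forall x, -oo < r x)%E /\ (exists x, r x < +oo)%E.

Definition convex_ereal r : Prop :=
  forall (t : R) (x y : 'rV[R]_d), 0 <= t <= 1 ->
  (r (t *: x + (1 - t) *: y)%R <= t%:E * r x + (1 - t)%:E * r y)%E.

(* Since +oo - +oo = -oo in \bar R, a solution necessarily has r xs finite
   when r is proper. *)
Definition rvi_solutions (F : 'rV[R]_d -> 'rV[R]_d) r : set 'rV[R]_d :=
  [set xs | forall x : 'rV[R]_d, (0 <= (dotp (F xs) (x - xs))%:E + r x - r xs)%E].

Definition argmin S r : set 'rV[R]_d :=
  [set x | S x /\ forall y, S y -> (r x <= r y)%E].

Definition prox (gamma : R) r (x : 'rV[R]_d) : set 'rV[R]_d :=
  argmin setT (fun y => r y + (norm2 (y - x) ^+ 2 / (2 * gamma))%:E)%E.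

Definition projection S (x : 'rV[R]_d) : 'rV[R]_d :=
  xget 0 (argmin S (fun y => (norm2 (y - x))%:E)).

(* A randomized map is given by the law Q x of its output at each input x. *)
Definition unbiased_compressor (omega : R)
    (Q : R.-pker ('rV[R]_d) ~> ('rV[R]_d)) : Prop :=
  forall x,
    (forall j, (Q x).-integrable setT (fun y : 'rV[R]_d => (y 0 j)%:E) /\
       (\int[Q x]_y (y 0 j)%:E = (x 0 j)%:E)%E) /\
    (\int[Q x]_y (norm2 (y - x) ^+ 2)%:E <= (omega * norm2 x ^+ 2)%:E)%E.

End Optimization.

(* Conditioning on the sigma-algebra <<s G >> generated by a family G of events;
   [g_sigma_algebraType G] is T equipped with that sigma-algebra. *)
Section Conditioning.
Context {dT : measure_display} {T : measurableType dT} {R : realType}.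
Variable P : probability T R.
Implicit Types (G : set (set T)) (X Y : T -> R).

(* Y is a version of the conditional expectation E[X | <<s G >>]. *)
Definition is_cond_exp G X Y : Prop :=
  [/\ P.-integrable setT (EFin \o X),
      P.-integrable setT (EFin \o Y),
      measurable_fun [set: g_sigma_algebraType G] Y &
      forall A, <<s G >> A ->
        (\int[P]_(w in A) (X w)%:E = \int[P]_(w in A) (Y w)%:E)%E].

(* E[X | <<s G >>] <= Y almost surely. *)
Definition cond_exp_le G X Y : Prop :=
  exists2 Z, is_cond_exp G X Z & {ae P, forall w, Z w <= Y w}.

Definition is_cond_exp_rV (d : nat) G (X Y : T -> 'rV[R]_d) : Prop :=
  forall j, is_cond_exp G (fun w => X w 0 j) (fun w => Y w 0 j).

(* Taking B i = setT for some of the indices gives the product rule for the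
   subfamilies. *)
Definition cond_independent (d n : nat) G (X : 'I_n -> T -> 'rV[R]_d) : Prop :=
  forall B : 'I_n -> set 'rV[R]_d, (forall i, measurable (B i)) ->
  exists p : 'I_n -> T -> R,
    (forall i, is_cond_exp G (\1_(X i @^-1` B i)) (p i)) /\
    is_cond_exp G (\1_(\bigcap_i (X i @^-1` B i))) (fun w => \prod_(i < n) p i w).

(* Given <<s G >>, the conditional law of Y is the law Q (X w). *)
Definition has_cond_law (d : nat) G (Q : R.-pker ('rV[R]_d) ~> ('rV[R]_d))
    (X Y : T -> 'rV[R]_d) : Prop :=
  forall B, measurable B ->
  is_cond_exp G (\1_(Y @^-1` B)) (fun w => fine (Q (X w) B)).

(* The events of G together with those determined by the vectors X i. *)
Definition joint_info (d n : nat) G (X : 'I_n -> T -> 'rV[R]_d) : set (set T) :=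
  G `|` \bigcup_i preimage_set_system setT (X i) measurable.

Definition is_filtration (Fil : nat -> set (set T)) : Prop :=
  forall k, [/\ sigma_algebra setT (Fil k), Fil k `<=` measurable &
                Fil k `<=` Fil k.+1].

End Conditioning.

Section DianaSGDA.
Context {dT : measure_display} {T : measurableType dT} {R : realType}.
Context {d n : nat}.

Definition average (v : 'I_n -> 'rV[R]_d) : 'rV[R]_d :=
  n%:R^-1 *: \sum_(i < n) v i.

(* A run of the algorithm on the probability space (T, P): [Fil k] is the
   information generated before iteration k, [gi i k] is the estimate computed
   by worker i and [q i k] is the realization of the compression of
   Delta_i^k = gi i k - hi i k.  Since the regularizer is proper, lower
   semicontinuous and convex, [prox] is a singleton set. *)
Record diana_sgda (P : probability T R) (Fil : nat -> set (set T))
    (gamma alpha : R) (reg : 'rV[R]_d -> \bar R)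
    (Q : R.-pker ('rV[R]_d) ~> ('rV[R]_d))
    (x0 : 'rV[R]_d) (h0 : 'I_n -> 'rV[R]_d)
    (x : nat -> T -> 'rV[R]_d) (hi : 'I_n -> nat -> T -> 'rV[R]_d)
    (h : nat -> T -> 'rV[R]_d) (gi q : 'I_n -> nat -> T -> 'rV[R]_d)
    (g : nat -> T -> 'rV[R]_d) : Prop := DianaSGDA {
  diana_x0 : forall w, x 0%N w = x0;
  diana_hi0 : forall i w, hi i 0%N w = h0 i;
  diana_h0 : forall w, h 0%N w = average h0;
  diana_hi : forall i k w, hi i k.+1 w = hi i k w + alpha *: q i k w;
  diana_g : forall k w, g k w = h k w + average (fun i => q i k w);
  diana_h : forall k w, h k.+1 w = h k w + alpha *: average (fun i => q i k w);
  diana_x : forall k w, prox gamma reg (x k w - gamma *: g k w) (x k.+1 w);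
  diana_filtration : is_filtration Fil;
  diana_x_adapted : forall k,
    measurable_fun [set: g_sigma_algebraType (Fil k)] (x k);
  diana_hi_adapted : forall i k,
    measurable_fun [set: g_sigma_algebraType (Fil k)] (hi i k);
  diana_gi_adapted : forall i k,
    measurable_fun [set: g_sigma_algebraType (Fil k.+1)] (gi i k);
  diana_q_adapted : forall i k,
    measurable_fun [set: g_sigma_algebraType (Fil k.+1)] (q i k);
  diana_gi_indep : forall k, cond_independent P (Fil k) (fun i => gi i k);
  diana_q_law : forall i k, has_cond_law P
    (joint_info (Fil k) (fun j => gi j k))
    Q (fun w => gi i k w - hi i k w) (q i k);
  diana_q_indep : forall k, cond_independent P
    (joint_info (Fil k) (fun j => gi j k))
    (fun i => q i k)
}.

Definition key_parametric_assumption (P : probability T R)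
    (Fil : nat -> set (set T)) (F : 'rV[R]_d -> 'rV[R]_d) (Xs : set 'rV[R]_d)
    (x g : nat -> T -> 'rV[R]_d) (A B C D1 D2 rho : R) (sigma : nat -> T -> R) :
    Prop :=
  [/\ 0 <= A, 0 <= B, 0 <= C, 0 <= D1 & 0 <= D2] /\
  0 < rho <= 1 /\
  (forall k w, 0 <= sigma k w) /\
  forall k,
  let xs w := projection Xs (x k w) in
  let gs w := F (xs w) in
  [/\ is_cond_exp_rV P (Fil k) (g k) (fun w => F (x k w)),
      cond_exp_le P (Fil k) (fun w => norm2 (g k w - gs w) ^+ 2)
        (fun w => 2 * A * dotp (F (x k w) - gs w) (x k w - xs w)
                  + B * sigma k w ^+ 2 + D1) &
      cond_exp_le P (Fil k) (fun w => sigma k.+1 w ^+ 2)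
        (fun w => 2 * C * dotp (F (x k w) - gs w) (x k w - xs w)
                  + (1 - rho) * sigma k w ^+ 2 + D2)].

End DianaSGDA.

(* Main.v *)
Require Import Defs.
From HB Require Import structures.
From mathcomp Require Import all_boot all_order all_algebra.
From mathcomp Require Import all_classical all_reals all_analysis.
From mathcomp Require Import measurable_realfun ring lra.

Set Implicit Arguments.
Unset Strict Implicit.
Unset Printing Implicit Defensive.

Import Order.TTheory GRing.Theory Num.Theory.
Import numFieldNormedType.Exports.

Local Open Scope classical_set_scope.
Local Open Scope ring_scope.

(** Let [xs] be the solution and write [D_i = g_i - h_i], [U_i = Q(D_i) - D_i]
    and [V_i = g_i - F_i(x)].  The error [g - F(xs)] is the sum of the averages
    of the [U_i] and of the [V_i] and of [F(x) - F(xs)]; unbiasedness and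
    conditional independence make all these terms orthogonal in L2 over every
    event of the past, so that only their squares have to be bounded.  The
    shift error is [(h_i - F_i(xs)) + alpha D_i + alpha U_i], and
    [alpha (1 + omega) <= 1] absorbs the compression noise.

    Inequalities between conditional expectations are tested on the events of
    the past.  Square integrability propagates along the run because
    co-coercivity makes each [F_i] Lipschitz at [xs] and the proximal step is
    nonexpansive towards its fixed point [xs]. *)

(** * Square integrable random variables *)

(** The randomness is specified on events only: independence is a product rule for indicators,
    compression a law evaluated on Borel sets. The estimates need integrals of products of
    coordinates. The transfer principle [eq_kernel_integral] bridges this gap twice. Comparing the
    Dirac mass at [q w] with [Q (D w)], it turns the conditional law into moments. Comparing Dirac
    masses weighted by the positive and by the negative part of a variable, it shows that a variable
    with zero integral over the events of a sigma-algebra is orthogonal in L2 to all that is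
    measurable for it ([gen_orthogonal]); pull-out and uncorrelatedness follow. Compression is
    conditioned on more than the past, namely on the past and all the g_i together, so centering
    takes place on two levels: U_i against the larger sigma-algebra, V_i against the past.
    Constants: D_i is V_i plus F_i(x) - h_i, and splitting the latter at F_i(xs) costs a factor 2,
    whence [B = 2 omega / n] and the [2 omega / n] in [2 A = (1 + 2 omega / n) lhat]; the 1 is
    Jensen on F(x) - F(xs). V_i enters once directly and omega times through compression, whence the
    [1 + omega] in [D1]. *)

Section eq_kernel_integral.
Local Open Scope ereal_scope.
Context d d' (X : measurableType d) (Y : measurableType d') (R : realType).
Variables (mu : {measure set X -> \bar R}) (D : set X) (mD : measurable D).
Implicit Types (l : X -> {measure set Y -> \bar R}) (f : Y -> \bar R).

Import HBNNSimple.

Let integral_nnsfunE l (h : {nnsfun Y >-> R}) :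
  (forall B, measurable B -> measurable_fun D (l ^~ B)) ->
  \int[mu]_(x in D) \int[l x]_y (h y)%:E =
  \sum_(r \in range h) r%:E * \int[mu]_(x in D) l x (h @^-1` [set r]).
Proof.
move=> ml; under eq_integral do rewrite integralT_nnsfun sintegralE.
rewrite ge0_integral_fsum//; last 2 first.
- by move=> r; apply: measurable_funeM; exact: ml.
- by move=> r x _; exact: nnsfun_mulemu_ge0.
apply: eq_fsbigr => r rh; rewrite ge0_integralZl//; first exact: ml.
by move: rh; rewrite inE => -[y _ <-]; rewrite lee_fin.
Qed.

Let cvg_integral_nnsfun l f (mf : measurable_fun setT f) :
  (forall B, measurable B -> measurable_fun D (l ^~ B)) ->
  (forall y, 0 <= f y) ->
  \int[mu]_(x in D) \int[l x]_y f y =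
  limn (fun n => \int[mu]_(x in D)
    \int[l x]_y (nnsfun_approx measurableT mf n y)%:E).
Proof.
move=> ml f0; pose h := nnsfun_approx measurableT mf.
have ndh y : {homo (fun n => (h n y)%:E) : n m / (n <= m)%N >-> n <= m}.
  by move=> a b ab; rewrite lee_fin; exact/lefP/nd_nnsfun_approx.
rewrite -monotone_convergence//; last 3 first.
- move=> n; rewrite [X in measurable_fun _ X](_ : _ = fun x =>
    \sum_(r \in range (h n)) r%:E * l x (h n @^-1` [set r])); last first.
    by apply/funext => x; rewrite integralT_nnsfun sintegralE.
  apply: emeasurable_fsum => // r.
  by apply: measurable_funeM; exact: ml.
- by move=> n x _; apply: integral_ge0 => // y _; rewrite lee_fin.
- move=> x _ a b ab; apply: ge0_le_integral => //.
  + by move=> y _; rewrite lee_fin.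
  + exact/measurable_EFinP.
  + exact/measurable_EFinP.
  + by move=> y _; exact: ndh.
apply: eq_integral => x _; rewrite -monotone_convergence//.
- by apply: eq_integral => y _; apply/esym/cvg_lim => //; exact: cvg_nnsfun_approx.
- by move=> n; exact/measurable_EFinP.
- by move=> n y _; rewrite lee_fin.
Qed.

(** For simple functions the double integral sees [l] only through the mixed masses of their level
    sets; monotone convergence, inside and outside, gives the rest. [l] is a plain family of
    measures, which admits Dirac masses weighted by a random variable. *)
Lemma eq_kernel_integral l1 l2 f :
  (forall B, measurable B -> measurable_fun D (l1 ^~ B)) ->
  (forall B, measurable B -> measurable_fun D (l2 ^~ B)) ->
  (forall B, measurable B ->
    \int[mu]_(x in D) l1 x B = \int[mu]_(x in D) l2 x B) ->
  measurable_fun setT f -> (forall y, 0 <= f y) ->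
  \int[mu]_(x in D) \int[l1 x]_y f y = \int[mu]_(x in D) \int[l2 x]_y f y.
Proof.
move=> ml1 ml2 l12 mf f0.
rewrite !(cvg_integral_nnsfun mf)//.
apply: congr_lim; apply/funext => n; rewrite !integral_nnsfunE//.
by apply: eq_fsbigr => r _; rewrite l12.
Qed.

End eq_kernel_integral.

Section square_integrable.
Context dT (T : measurableType dT) (R : realType) (P : probability T R).
Implicit Types (f g : T -> R) (A : set T).

(** Measurability of [f] is a separate clause because integrability of its square does not imply
    it. *)
Definition sqint f : Prop :=
  measurable_fun setT f /\ P.-integrable setT (EFin \o (fun w => f w ^+ 2)).

Lemma ge0_integrable_fin f : measurable_fun setT f -> (forall w, 0 <= f w) ->
  (\int[P]_w (f w)%:E < +oo)%E -> P.-integrable setT (EFin \o f).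
Proof.
move=> mf f0 foo; apply/integrableP; split; first exact/measurable_EFinP.
by under eq_integral => w _ do rewrite /= ger0_norm//.
Qed.

Lemma le_integrableR f g : measurable_fun setT f ->
  (forall w, `|f w| <= g w) -> P.-integrable setT (EFin \o g) ->
  P.-integrable setT (EFin \o f).
Proof.
move=> mf fg; apply: le_integrable => //; first exact/measurable_EFinP.
by move=> w _ /=; rewrite lee_fin (le_trans (fg w))// ler_norm.
Qed.

Lemma integrable_cstR (c : R) : P.-integrable setT (EFin \o (fun=> c)).
Proof. exact: finite_measure_integrable_cst. Qed.

Lemma integrableDR f g : P.-integrable setT (EFin \o f) ->
  P.-integrable setT (EFin \o g) ->
  P.-integrable setT (EFin \o (fun w => f w + g w)).
Proof. by move=> fi gi; have := integrableD measurableT fi gi. Qed.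

Lemma integrableBR f g : P.-integrable setT (EFin \o f) ->
  P.-integrable setT (EFin \o g) ->
  P.-integrable setT (EFin \o (fun w => f w - g w)).
Proof. by move=> fi gi; have := integrableB measurableT fi gi. Qed.

Lemma integrableZR c f : P.-integrable setT (EFin \o f) ->
  P.-integrable setT (EFin \o (fun w => c * f w)).
Proof. by move=> fi; have := integrableZl measurableT c fi. Qed.

Lemma integrable_sumR (I : Type) (s : seq I) (F : I -> T -> R) :
  (forall i, P.-integrable setT (EFin \o F i)) ->
  P.-integrable setT (EFin \o (fun w => \sum_(i <- s) F i w)).
Proof.
move=> Fi; elim: s => [|i s ih].
  by under eq_fun do rewrite big_nil; exact: integrable_cstR.
by under eq_fun do rewrite big_cons; exact: integrableDR.
Qed.

Lemma integrable_measurable f : P.-integrable setT (EFin \o f) ->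
  measurable_fun setT f.
Proof. by move=> /measurable_int/measurable_EFinP. Qed.

Lemma sqint_le f g : measurable_fun setT f -> (forall w, `|f w| <= `|g w|) ->
  sqint g -> sqint f.
Proof.
move=> mf fg [mg ig]; split => //.
apply: le_integrableR ig; first exact: measurable_funX.
by move=> w; rewrite normrX -[leRHS]real_normK ?num_real// lerXn2r// nnegrE.
Qed.

Lemma sqint_cst (c : R) : sqint (fun=> c).
Proof. by split => //; exact: integrable_cstR. Qed.

Lemma sqintM f g : sqint f -> sqint g ->
  P.-integrable setT (EFin \o (fun w => f w * g w)).
Proof.
move=> [mf fi] [mg gi]; apply: (le_integrableR _ _ (integrableDR fi gi)).
  exact: measurable_funM.
move=> w; rewrite ler_norml.
have := sqr_ge0 (f w + g w); have := sqr_ge0 (f w - g w).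
have := sqr_ge0 (f w); have := sqr_ge0 (g w).
by move=> *; apply/andP; split; nra.
Qed.

Lemma sqintW f : sqint f -> P.-integrable setT (EFin \o f).
Proof.
move=> fi; have := sqintM fi (sqint_cst 1).
by under eq_fun do rewrite mulr1.
Qed.

Lemma sqintD f g : sqint f -> sqint g -> sqint (fun w => f w + g w).
Proof.
move=> fi gi; split; first exact: (measurable_funD fi.1 gi.1).
have := integrableDR (integrableDR fi.2 gi.2) (integrableZR 2 (sqintM fi gi)).
by apply: eq_integrable => // w _ /=; congr EFin; ring.
Qed.

Lemma sqintZ c f : sqint f -> sqint (fun w => c * f w).
Proof.
move=> fi; split; first by apply: measurable_funM => //; exact: fi.1.
have := integrableZR (c ^+ 2) fi.2.
by apply: eq_integrable => // w _ /=; congr EFin; ring.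
Qed.

Lemma sqintB f g : sqint f -> sqint g -> sqint (fun w => f w - g w).
Proof.
move=> fi gi; have := sqintD fi (sqintZ (-1) gi).
by under eq_fun do rewrite mulN1r.
Qed.

Lemma sqint_sum (I : Type) (s : seq I) (F : I -> T -> R) :
  (forall i, sqint (F i)) -> sqint (fun w => \sum_(i <- s) F i w).
Proof.
move=> Fi; elim: s => [|i s ih].
  by under eq_fun do rewrite big_nil; exact: sqint_cst.
by under eq_fun do rewrite big_cons; exact: sqintD.
Qed.

Lemma sqint_indicM A f : measurable A -> sqint f ->
  sqint (fun w => \1_A w * f w).
Proof.
move=> mA fi; apply: (sqint_le _ _ fi).
  by apply: measurable_funM; [exact: measurable_indic|exact: fi.1].
move=> w; rewrite normrM indicE; case: (_ \in _); rewrite ?normr1 ?mul1r//.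
by rewrite normr0 mul0r.
Qed.

Lemma sqint_indic A : measurable A -> sqint (\1_A).
Proof.
move=> mA; have := sqint_indicM mA (sqint_cst 1).
by under eq_fun do rewrite mulr1.
Qed.

Lemma Rintegral_indicM A f :
  \int[P]_(w in A) f w = \int[P]_w (\1_A w * f w).
Proof.
rewrite Rintegral_mkcond; apply: eq_Rintegral => w _.
by rewrite patchE indicE; case: ifP; rewrite ?mul1r ?mul0r.
Qed.

Lemma RintegralM A f : measurable A -> P.-integrable setT (EFin \o f) ->
  (\int[P]_(w in A) f w)%:E = (\int[P]_(w in A) (f w)%:E)%E.
Proof.
move=> mA fi; rewrite /Rintegral fineK//; apply: integrable_fin_num => //.
exact: integrableS fi.
Qed.

Lemma RintegralDT A f g : measurable A ->
  P.-integrable setT (EFin \o f) -> P.-integrable setT (EFin \o g) ->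
  \int[P]_(w in A) (f w + g w) = \int[P]_(w in A) f w + \int[P]_(w in A) g w.
Proof.
move=> mA fi gi.
by rewrite RintegralD//; [exact: integrableS fi|exact: integrableS gi].
Qed.

Lemma RintegralBT A f g : measurable A ->
  P.-integrable setT (EFin \o f) -> P.-integrable setT (EFin \o g) ->
  \int[P]_(w in A) (f w - g w) = \int[P]_(w in A) f w - \int[P]_(w in A) g w.
Proof.
move=> mA fi gi.
by rewrite RintegralB//; [exact: integrableS fi|exact: integrableS gi].
Qed.

Lemma RintegralZT A c f : measurable A -> P.-integrable setT (EFin \o f) ->
  \int[P]_(w in A) (c * f w) = c * \int[P]_(w in A) f w.
Proof. by move=> mA fi; rewrite RintegralZl//; exact: integrableS fi. Qed.

Lemma Rintegral_sumT A (I : Type) (s : seq I) (F : I -> T -> R) :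
  measurable A -> (forall i, P.-integrable setT (EFin \o F i)) ->
  \int[P]_(w in A) \sum_(i <- s) F i w = \sum_(i <- s) \int[P]_(w in A) F i w.
Proof.
move=> mA Fi; elim: s => [|i s ih].
  rewrite big_nil; under eq_Rintegral do rewrite big_nil.
  by rewrite Rintegral_cst// mul0r.
rewrite big_cons -ih; under eq_Rintegral do rewrite big_cons.
by rewrite RintegralDT//; exact: integrable_sumR.
Qed.

Lemma Rintegral_cstT c : \int[P]_w c = c.
Proof.
rewrite Rintegral_cst// -[RHS]mulr1; congr (_ * _).
by transitivity (fine 1%:E : R) => //; congr fine; exact: probability_setT.
Qed.

Lemma le_RintegralT A f g : measurable A ->
  P.-integrable setT (EFin \o f) -> P.-integrable setT (EFin \o g) ->
  (forall w, f w <= g w) ->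
  \int[P]_(w in A) f w <= \int[P]_(w in A) g w.
Proof.
move=> mA fi gi fg; apply: le_Rintegral => //.
- exact: integrableS fi.
- exact: integrableS gi.
Qed.

End square_integrable.

(** * Conditional expectations *)

Section sub_sigma_algebra.
Context dT (T : measurableType dT).
Variables (G : set (set T)) (sG : G `<=` measurable).

Lemma gen_measurable : <<s G >> `<=` @measurable _ T.
Proof. by apply: smallest_sub => //; exact: sigma_algebra_measurable. Qed.

Lemma gen_measurable_fun d (Y : measurableType d) (f : T -> Y) :
  measurable_fun [set: g_sigma_algebraType G] f -> measurable_fun setT f.
Proof.
move=> mf _ B mB; rewrite setTI; apply: gen_measurable.
by rewrite -[_ @^-1` _]setTI; exact: mf.
Qed.

Lemma measurable_gen_id :
  measurable_fun setT (id : T -> g_sigma_algebraType G).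
Proof. by move=> _ B mB; rewrite setTI; exact: gen_measurable. Qed.

End sub_sigma_algebra.

Section cond_exp_existence.
Local Open Scope ereal_scope.
Context dT (T : measurableType dT) (R : realType) (P : probability T R).
Variables (G : set (set T)) (sG : G `<=` measurable).
Variables (X : T -> R) (Xi : P.-integrable setT (EFin \o X)).

(* The two proof arguments let the charge structure be inferred. *)
Definition gen_charge of G `<=` measurable & P.-integrable setT (EFin \o X) :
  set (g_sigma_algebraType G) -> \bar R := fun A => \int[P]_(w in A) (X w)%:E.

Let gen_charge0 : gen_charge sG Xi set0 = 0.
Proof. by rewrite /gen_charge integral_set0. Qed.

Let gen_charge_fin A : measurable A -> gen_charge sG Xi A \is a fin_num.
Proof.
move=> /(gen_measurable sG) mA; apply: integrable_fin_num => //.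
exact: integrableS Xi.
Qed.

Let gen_charge_sigma_additive : semi_sigma_additive (gen_charge sG Xi).
Proof.
move=> F mF tF mUF.
apply: (charge_semi_sigma_additive (s := induced_charge Xi)) => //.
- by move=> i; exact: gen_measurable (mF i).
- exact: gen_measurable mUF.
Qed.

HB.instance Definition _ := isCharge.Build _ _ _ (gen_charge sG Xi)
  gen_charge0 gen_charge_fin gen_charge_sigma_additive.

Let gen_id : {mfun T >-> g_sigma_algebraType G} :=
  mfun_Sub (mem_set (measurable_gen_id sG)).

(** The version is the Radon-Nikodym derivative of [gen_charge] with respect to the restriction of
    [P] to [<<s G >>]. That restriction is obtained as the distribution of the identity map into the
    coarser space. *)
Lemma is_cond_exp_exists : exists Z, is_cond_exp P G X Z.
Proof.
pose mu := distribution P gen_id.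
have numu : gen_charge sG Xi `<< mu.
  apply/null_content_dominatesP => A mA muA; rewrite /gen_charge.
  apply: null_set_integral => //; first exact: gen_measurable mA.
  by apply: measurable_funTS; exact: measurable_int Xi.
pose f := Radon_Nikodym (gen_charge sG Xi) mu.
have fE w : (fine (f w))%:E = f w by rewrite fineK// Radon_Nikodym_fin_num.
have mf : measurable_fun [set: g_sigma_algebraType G] f.
  by apply: measurable_int; exact: Radon_Nikodym_integrable.
have fi : P.-integrable setT f.
  apply/integrableP; split; first exact: gen_measurable_fun mf.
  have /integrableP[_] := Radon_Nikodym_integrable numu.
  by rewrite ge0_integral_distribution//; exact: measurableT_comp.
exists (fine \o f); split => //.
- by apply: eq_integrable fi => // w _; rewrite /= fE.
- exact: measurableT_comp mf.
- move=> A mA; transitivity (gen_charge sG Xi A) => //.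
  rewrite (Radon_Nikodym_integral numu)//.
  rewrite (integral_pushforward (measurable_gen_id sG))//=.
  + by apply: eq_integral => w _; rewrite /= fE.
  + exact: (integrableS measurableT (gen_measurable sG mA) _ fi).
Qed.

End cond_exp_existence.

Lemma ae_eq_Rintegral dT (T : measurableType dT) (R : realType)
    (P : probability T R) (A : set T) (f g : T -> R) : measurable A ->
  measurable_fun setT f -> measurable_fun setT g ->
  {ae P, forall w, f w = g w} ->
  \int[P]_(w in A) f w = \int[P]_(w in A) g w.
Proof.
move=> mA mf mg fg; congr fine; apply: ae_eq_integral => //.
- by apply/measurable_EFinP; exact: measurable_funTS.
- by apply/measurable_EFinP; exact: measurable_funTS.
- by apply: filterS fg => w /= ->.
Qed.

Lemma ae_le_Rintegral dT (T : measurableType dT) (R : realType)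
    (P : probability T R) (A : set T) (f g : T -> R) : measurable A ->
  P.-integrable setT (EFin \o f) -> P.-integrable setT (EFin \o g) ->
  {ae P, forall w, f w <= g w} ->
  \int[P]_(w in A) f w <= \int[P]_(w in A) g w.
Proof.
move=> mA fi gi fg.
have mf := integrable_measurable fi; have mg := integrable_measurable gi.
have mM : measurable_fun setT (fun w => Num.max (f w) (g w)).
  exact: measurable_maxr.
(* The maximum is almost surely [g] and dominates [f] everywhere, so pointwise monotonicity of the
   integral suffices. *)
have -> : \int[P]_(w in A) g w = \int[P]_(w in A) Num.max (f w) (g w).
  by apply: ae_eq_Rintegral => //; apply: filterS fg => w /max_idPr.
apply: le_Rintegral => //.
- exact: integrableS fi.
- apply: (integrableS measurableT) => //.
  apply: (le_integrableR mM _
    (integrableDR (integrable_norm fi) (integrable_norm gi))).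
  by move=> w /=; case: (leP (f w) (g w)) => _; rewrite ?lerDr// lerDl.
- by move=> w _; rewrite le_max lexx.
Qed.

Section cond_exp.
Context dT (T : measurableType dT) (R : realType) (P : probability T R).
Variables (G : set (set T)) (sG : G `<=` measurable).
Implicit Types (X Y Z U : T -> R) (A : set T).

Lemma is_cond_expP X Y : P.-integrable setT (EFin \o X) ->
  P.-integrable setT (EFin \o Y) ->
  measurable_fun [set: g_sigma_algebraType G] Y ->
  (forall A, <<s G >> A -> \int[P]_(w in A) X w = \int[P]_(w in A) Y w) ->
  is_cond_exp P G X Y.
Proof.
move=> Xi Yi mY XY; split => // A GA.
by rewrite -!RintegralM ?XY//; exact: gen_measurable GA.
Qed.

Lemma cond_exp_Rintegral X Y A : is_cond_exp P G X Y -> <<s G >> A ->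
  \int[P]_(w in A) X w = \int[P]_(w in A) Y w.
Proof. by move=> [_ _ _ XY] GA; rewrite /Rintegral XY. Qed.

(** The event where [Y] exceeds [Z] belongs to [<<s G >>]. There [Y - Z] is positive but has a
    nonpositive integral, so the event is null. *)
Lemma ae_le_gen Y Z :
  P.-integrable setT (EFin \o Y) -> P.-integrable setT (EFin \o Z) ->
  measurable_fun [set: g_sigma_algebraType G] Y ->
  measurable_fun [set: g_sigma_algebraType G] Z ->
  (forall A, <<s G >> A -> \int[P]_(w in A) Y w <= \int[P]_(w in A) Z w) ->
  {ae P, forall w, Y w <= Z w}.
Proof.
move=> Yi Zi mY mZ YZ.
pose A := (fun w => Y w - Z w) @^-1` `]0, +oo[.
have GA : <<s G >> A.
  have mYZ := measurable_funB mY mZ.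
  by rewrite -[A]setTI; exact: (mYZ measurableT _ (measurable_itv _)).
have mA := gen_measurable sG GA.
have iS f : P.-integrable setT (EFin \o f) -> P.-integrable A (EFin \o f).
  exact: integrableS.
have iD : P.-integrable A (EFin \o (fun w => Y w - Z w)).
  exact: iS (integrableBR Yi Zi).
have D0 w : A w -> 0 < Y w - Z w by rewrite /A/= in_itv/= andbT.
have /eqP : \int[P]_(w in A) (Y w - Z w) = 0.
  apply/eqP; rewrite eq_le; apply/andP; split.
    by rewrite RintegralB ?subr_le0 ?YZ//; exact: iS.
  by apply: Rintegral_ge0 => w /D0/ltW.
rewrite -eqe /Rintegral fineK ?integrable_fin_num// => /eqP I0.
have I1 : (\int[P]_(x in A) `|(Y x - Z x)%:E| = 0)%E.
  rewrite -[RHS]I0; apply: eq_integral => w; rewrite inE => /D0 ?.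
  by rewrite /= gtr0_norm.
have [/(_ I1) YZ0 _] := ae_eq_integral_abs P mA (measurable_int _ iD).
apply: filterS YZ0 => w /= YZw; rewrite leNgt; apply/negP => ZY.
have Aw : A w by rewrite /A/= in_itv/= andbT subr_gt0.
by move: (YZw Aw) (D0 _ Aw) => [->]; rewrite ltxx.
Qed.

Lemma ae_eq_gen Y Z :
  P.-integrable setT (EFin \o Y) -> P.-integrable setT (EFin \o Z) ->
  measurable_fun [set: g_sigma_algebraType G] Y ->
  measurable_fun [set: g_sigma_algebraType G] Z ->
  (forall A, <<s G >> A -> \int[P]_(w in A) Y w = \int[P]_(w in A) Z w) ->
  {ae P, forall w, Y w = Z w}.
Proof.
move=> Yi Zi mY mZ YZ.
have YleZ : {ae P, forall w, Y w <= Z w}.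
  by apply: ae_le_gen => // A GA; rewrite YZ.
have ZleY : {ae P, forall w, Z w <= Y w}.
  by apply: ae_le_gen => // A GA; rewrite YZ.
by apply: filterS2 YleZ ZleY => w ? ?; apply: le_anti; apply/andP.
Qed.

(** This is the passage in both directions between conditional bounds and integrals over events: it
    opens the variance hypothesis and closes both recursions. Since [Y] is measurable for the
    sub-sigma-algebra, [ae_le_gen] can compare it with the version whose existence was just
    proved. *)
Lemma cond_exp_leP X Y : P.-integrable setT (EFin \o X) ->
  P.-integrable setT (EFin \o Y) ->
  measurable_fun [set: g_sigma_algebraType G] Y ->
  cond_exp_le P G X Y <->
  forall A, <<s G >> A -> \int[P]_(w in A) X w <= \int[P]_(w in A) Y w.
Proof.
move=> Xi Yi mY; split.
  move=> [Z XZ ZY] A GA; have [_ Zi mZ _] := XZ.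
  have mA := gen_measurable sG GA.
  by rewrite (cond_exp_Rintegral XZ GA); exact: ae_le_Rintegral.
move=> XY; have [Z XZ] := is_cond_exp_exists sG Xi; exists Z => //.
have [_ Zi mZ _] := XZ.
by apply: ae_le_gen => // A GA; rewrite -(cond_exp_Rintegral XZ GA) XY.
Qed.

End cond_exp.

Section cond_exp_orthogonality.
Context dT (T : measurableType dT) (R : realType) (P : probability T R).
Variables (G : set (set T)) (sG : G `<=` measurable).
Implicit Types (U Z : T -> R) (A : set T).

Let integral_scaled_dirac (V : T -> R) (V0 : forall w, 0 <= V w)
    (f : g_sigma_algebraType G -> \bar R) w :
  measurable_fun setT f -> (forall y, 0 <= f y)%E ->
  (\int[mscale (NngNum (V0 w)) (\d_(w : g_sigma_algebraType G))]_y f y =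
    (V w)%:E * f w)%E.
Proof.
by move=> mf f0; rewrite ge0_integral_mscale// integral_dirac// diracT mul1e.
Qed.

(** The Dirac masses at [w], weighted by the positive and the negative part of [U], are taken on the
    coarser sigma-algebra. Their mixed masses agree there because [U] integrates to zero over its
    events. The equality is between extended reals, so the products need not be known integrable. *)
Let orthogonal_pos_neg U Z : P.-integrable setT (EFin \o U) ->
  (forall A, <<s G >> A -> \int[P]_(w in A) U w = 0) ->
  measurable_fun [set: g_sigma_algebraType G] Z -> (forall w, 0 <= Z w) ->
  (\int[P]_w (U^\+ w * Z w)%:E = \int[P]_w (U^\- w * Z w)%:E)%E.
Proof.
move=> Ui U0 mZ Z0; have mU := integrable_measurable Ui.
pose l (V : T -> R) (V0 : forall w, 0 <= V w) (w : T) :=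
  mscale (NngNum (V0 w)) (\d_(w : g_sigma_algebraType G))
  : {measure set (g_sigma_algebraType G) -> \bar R}.
have lE (V : T -> R) (V0 : forall w, 0 <= V w) :
    (\int[P]_w (V w * Z w)%:E = \int[P]_w \int[l V V0 w]_y (Z y)%:E)%E.
  apply: eq_integral => w _; rewrite integral_scaled_dirac ?EFinM//.
  exact/measurable_EFinP.
have lB (V : T -> R) (V0 : forall w, 0 <= V w) B w :
    l V V0 w B = ((V w)%:E * (\1_B w)%:E)%E.
  by [].
have ml (V : T -> R) (V0 : forall w, 0 <= V w)
    (B : set (g_sigma_algebraType G)) :
    measurable_fun setT V -> measurable B ->
    measurable_fun setT (l V V0 ^~ B).
  move=> mV mB; under eq_fun do rewrite lB -EFinM.
  apply/measurable_EFinP/measurable_funM => //.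
  by apply: measurable_indic; exact: gen_measurable mB.
rewrite (lE _ (funrpos_ge0 U)) (lE _ (funrneg_ge0 U)).
apply: eq_kernel_integral => //.
- by move=> B mB; apply: ml => //; exact: measurable_funrpos.
- by move=> B mB; apply: ml => //; exact: measurable_funrneg.
- move=> B mB; have mB' := gen_measurable sG mB.
  have UB (V : T -> R) :
    (\int[P]_w ((V w)%:E * (\1_B w)%:E) = \int[P]_(w in B) (V w)%:E)%E.
    rewrite [RHS]integral_mkcond; apply: eq_integral => w _.
    by rewrite patchE indicE; case: ifP; rewrite ?mule1 ?mule0.
  rewrite !UB.
  have Up := integrable_funrpos measurableT Ui.
  have Un := integrable_funrneg measurableT Ui.
  rewrite -!RintegralM//; congr EFin; apply/eqP; rewrite -subr_eq0 -RintegralB//.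
  + rewrite -[X in _ == X](U0 B mB); apply/eqP/eq_Rintegral => w _.
    by rewrite -[in RHS](funrposBneg U).
  + exact: integrableS Up.
  + exact: integrableS Un.
- exact/measurable_EFinP.
Qed.

Let orthogonal_ge0 U Z : sqint P U -> sqint P Z ->
  (forall A, <<s G >> A -> \int[P]_(w in A) U w = 0) ->
  measurable_fun [set: g_sigma_algebraType G] Z -> (forall w, 0 <= Z w) ->
  \int[P]_w (U w * Z w) = 0.
Proof.
move=> U2 Z2 U0 mZ Z0.
have UE := orthogonal_pos_neg (sqintW U2) U0 mZ Z0.
have le_pos w : `|U^\+ w| <= `|U w|.
  by rewrite -[`|U w|]/((Num.norm \o U) w) -funrposDneg ger0_norm ?lerDl.
have le_neg w : `|U^\- w| <= `|U w|.
  by rewrite -[`|U w|]/((Num.norm \o U) w) -funrposDneg ger0_norm ?lerDr.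
have p2 := sqint_le (measurable_funrpos U2.1) le_pos U2.
have n2 := sqint_le (measurable_funrneg U2.1) le_neg U2.
transitivity (\int[P]_w (U^\+ w * Z w - U^\- w * Z w)).
  by apply: eq_Rintegral => w _; rewrite -mulrBl -[in LHS](funrposBneg U).
by rewrite RintegralB ?[X in X - _]/Rintegral ?UE ?subrr//; exact: sqintM.
Qed.

(** The indicator of [A] is absorbed into the measurable factor, whose positive and negative parts
    are then treated separately. Square integrability makes every product integrable, so that the
    differences are legitimate. *)
Lemma gen_orthogonal U Z A : sqint P U -> sqint P Z ->
  (forall B, <<s G >> B -> \int[P]_(w in B) U w = 0) ->
  measurable_fun [set: g_sigma_algebraType G] Z -> <<s G >> A ->
  \int[P]_(w in A) (U w * Z w) = 0.
Proof.
move=> U2 Z2 U0 mZ GA; have mA := gen_measurable sG GA.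
pose V w := \1_A w * Z w.
have V2 : sqint P V by exact: sqint_indicM.
have mV : measurable_fun [set: g_sigma_algebraType G] V.
  by apply: measurable_funM => //; exact: measurable_indic.
have Vle w : `|V^\+ w| <= `|V w| /\ `|V^\- w| <= `|V w|.
  rewrite -[`|V w|]/((Num.norm \o V) w) -funrposDneg !ger0_norm//.
  by rewrite lerDl lerDr.
have p2 := sqint_le (measurable_funrpos V2.1) (fun w => (Vle w).1) V2.
have n2 := sqint_le (measurable_funrneg V2.1) (fun w => (Vle w).2) V2.
rewrite Rintegral_indicM.
transitivity (\int[P]_w (U w * V^\+ w - U w * V^\- w)).
  apply: eq_Rintegral => w _; rewrite -mulrBr -[V^\+ w - _]/((V^\+ - V^\-) w).
  by rewrite funrposBneg /V; ring.
rewrite RintegralB//; [|exact: sqintM|exact: sqintM].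
rewrite !orthogonal_ge0 ?subrr//; first exact: measurable_funrneg.
exact: measurable_funrpos.
Qed.

End cond_exp_orthogonality.

Section cond_exp_pull_out.
Context dT (T : measurableType dT) (R : realType) (P : probability T R).
Variables (G : set (set T)) (sG : G `<=` measurable).
Implicit Types (X Y Z : T -> R) (A : set T).

Lemma cond_exp_pull_out X Y Z A : is_cond_exp P G X Y ->
  sqint P X -> sqint P Y -> sqint P Z ->
  measurable_fun [set: g_sigma_algebraType G] Z -> <<s G >> A ->
  \int[P]_(w in A) (X w * Z w) = \int[P]_(w in A) (Y w * Z w).
Proof.
move=> XY X2 Y2 Z2 mZ GA; have mA := gen_measurable sG GA.
have iS f : P.-integrable setT (EFin \o f) -> P.-integrable A (EFin \o f).
  exact: integrableS.
apply/eqP; rewrite -subr_eq0 -RintegralB//; [|exact/iS/sqintM|exact/iS/sqintM].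
apply/eqP; rewrite -[RHS](gen_orthogonal sG (sqintB X2 Y2) Z2 _ mZ GA).
  by apply: eq_Rintegral => w _; rewrite mulrBl.
move=> B GB; have mB := gen_measurable sG GB.
rewrite RintegralB ?(cond_exp_Rintegral XY GB) ?subrr//.
- exact: integrableS (sqintW X2).
- exact: integrableS (sqintW Y2).
Qed.

(** A version of a conditional probability is by definition only integrable. These bounds put it in
    L2, where [cond_exp_pull_out] applies. *)
Lemma cond_exp_indic_ae B p : measurable B -> is_cond_exp P G (\1_B) p ->
  {ae P, forall w, 0 <= p w <= 1}.
Proof.
move=> mB Bp; have [Bi pi mp _] := Bp.
have iA A f : <<s G >> A -> P.-integrable setT (EFin \o f) ->
    P.-integrable A (EFin \o f).
  by move=> /(gen_measurable sG) mA; exact: integrableS.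
have p0 : {ae P, forall w, 0 <= p w}.
  apply: (ae_le_gen sG (integrable_cstR P 0)) => // A GA.
  rewrite -(cond_exp_Rintegral Bp GA); apply: le_Rintegral => //.
  - exact: gen_measurable GA.
  - by apply: iA => //; exact: integrable_cstR.
  - exact: iA.
have p1 : {ae P, forall w, p w <= 1}.
  apply: (ae_le_gen sG _ (integrable_cstR P 1)) => // A GA.
  rewrite -(cond_exp_Rintegral Bp GA); apply: le_Rintegral => //.
  - exact: gen_measurable GA.
  - exact: iA.
  - by apply: iA => //; exact: integrable_cstR.
by move: p0 p1; apply: filterS2 => w p0 p1; apply/andP.
Qed.

Lemma sqint_ae_le1 (f : T -> R) : measurable_fun setT f ->
  {ae P, forall w, 0 <= f w <= 1} -> sqint P f.
Proof.
move=> mf f01; split => //; apply: ge0_integrable_fin.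
- exact: measurable_funX.
- by move=> w; exact: sqr_ge0.
- apply: (@le_lt_trans _ _ (\int[P]_w 1)%E).
    apply: ae_ge0_le_integral => //.
    + by move=> w _; rewrite lee_fin sqr_ge0.
    + exact/measurable_EFinP/measurable_funX.
    + by apply: filterS f01 => w /andP[f0 f1] _; rewrite lee_fin expr_le1.
  rewrite integral_cst// mul1e.
  by apply: (le_lt_trans (probability_le1 P measurableT)); exact: ltry.
Qed.

End cond_exp_pull_out.

(** * Conditional independence *)

Lemma measurable_coord (R : realType) (d : nat) (j : 'I_d) :
  measurable_fun setT (fun v : 'rV[R]_d => v 0 j).
Proof.
move=> _ B mB; rewrite setTI; apply: sub_sigma_algebra => /=.
rewrite -bigcup_seq/=; exists j => /=; first by rewrite mem_index_enum.
by exists B => //; rewrite setTI.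
Qed.

Section cond_independence.
Context dT (T : measurableType dT) (R : realType) (P : probability T R).
Variables (G : set (set T)) (sG : G `<=` measurable).
Variables (d n : nat) (X : 'I_n -> T -> 'rV[R]_d).
Hypothesis mX : forall i, measurable_fun setT (X i).
Hypothesis indepX : cond_independent P G X.

Lemma cond_independent_pair i j (B B' : set 'rV[R]_d) : i != j ->
  measurable B -> measurable B' ->
  exists p p' : T -> R, [/\ is_cond_exp P G (\1_(X i @^-1` B)) p,
    is_cond_exp P G (\1_(X j @^-1` B')) p' &
    forall A, <<s G >> A ->
      \int[P]_(w in A) (\1_(X i @^-1` B) w * \1_(X j @^-1` B') w) =
      \int[P]_(w in A) (p w * p' w)].
Proof.
move=> ij mB mB'.
pose Bs k := if k == i then B else if k == j then B' else setT.
have mBs k : measurable (Bs k) by rewrite /Bs; case: ifP => // _; case: ifP.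
have [p [pE prodE]] := indepX mBs.
have ji : j == i = false by rewrite eq_sym (negbTE ij).
have pi := pE i; have pj := pE j.
rewrite /Bs eqxx in pi; rewrite /Bs ji eqxx in pj.
exists (p i), (p j); split => // A GA.
have capE : \bigcap_k (X k @^-1` Bs k) = X i @^-1` B `&` X j @^-1` B'.
  apply/seteqP; split => [w wB|w [wi wj] k _]; last first.
    by rewrite /Bs/=; case: eqP => [->//|_]; case: eqP => [->//|_].
  split; first by have := wB i I; rewrite /Bs/= eqxx.
  by have := wB j I; rewrite /Bs/= ji eqxx.
rewrite capE indicI in prodE.
rewrite (cond_exp_Rintegral prodE GA).
have [_ pii mpi _] := pi; have [_ pji mpj _] := pj; have [_ prodi mprod _] := prodE.
apply: ae_eq_Rintegral;
  [exact: gen_measurable GA|exact: integrable_measurable prodi| |].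
  exact: measurable_funM (integrable_measurable pii) (integrable_measurable pji).
(* The remaining indices carry [setT]; their factors are versions of the conditional expectation of
   1, hence equal 1 only almost surely. *)
have p1 : {ae P, forall w, forall k, k != i -> k != j -> p k w = 1}.
  apply: filter_forall => k.
  case: (boolP ((k != i) && (k != j))) => [/andP[/negbTE ki /negbTE kj]|nk].
    have := pE k; rewrite /Bs ki kj preimage_setT => pk.
    have [_ pki mpk _] := pk.
    have : {ae P, forall w, p k w = 1}.
      apply: (ae_eq_gen sG pki (integrable_cstR P 1)) => // A' GA'.
      rewrite -(cond_exp_Rintegral pk GA'); apply: eq_Rintegral => w _.
      by rewrite indicT.
    by apply: filterS.
  by apply: aeW => w ki kj; rewrite ki kj in nk.
apply: filterS p1 => w pw.
rewrite (bigD1 i)//= (bigD1 j) ?ji//= big1 ?mulr1// => k /andP[ki kj].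
exact: pw.
Qed.

Variables (i j : 'I_n) (a b : 'I_d) (Xh Yh : T -> R).
Hypotheses (ij : i != j) (X2 : sqint P (fun w => X i w 0 a))
  (Y2 : sqint P (fun w => X j w 0 b)) (Xh2 : sqint P Xh) (Yh2 : sqint P Yh).
Hypotheses (XXh : is_cond_exp P G (fun w => X i w 0 a) Xh)
  (YYh : is_cond_exp P G (fun w => X j w 0 b) Yh).

Let orthogonal_component k c U : sqint P U ->
  sqint P (fun w => X k w 0 c) ->
  (forall B, measurable B -> \int[P]_(w in X k @^-1` B) U w = 0) ->
  \int[P]_w (U w * X k w 0 c) = 0.
Proof.
move=> U2 Xk2 U0.
pose H := preimage_set_system setT (X k) measurable.
have sH : H `<=` measurable by move=> _ [B mB <-]; exact: mX.
have HE : <<s H >> = H.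
  by apply: smallest_id; exact: sigma_algebra_preimage (sigma_algebra_measurable _).
apply: (gen_orthogonal (A := setT) sH U2 Xk2).
- by move=> C; rewrite HE => -[B mB <-]; rewrite setTI; exact: U0.
- apply: (measurableT_comp (measurable_coord c)).
  move=> _ B mB; rewrite setTI; apply: sub_sigma_algebra.
  by exists B => //; rewrite setTI.
- exact: (@measurableT _ (g_sigma_algebraType H)).
Qed.

(** Both sides equal the integral of [p * q'], with [q'] a conditional probability of the event on
    [X j]: the left one by the product rule, the right one by pull-out. *)
Let indic_pull_out B p B' A : measurable B -> measurable B' ->
  is_cond_exp P G (\1_(X i @^-1` B)) p -> <<s G >> A ->
  \int[P]_(w in A) (\1_(X i @^-1` B) w * \1_(X j @^-1` B') w) =
  \int[P]_(w in A) (p w * \1_(X j @^-1` B') w).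
Proof.
move=> mB mB' Bp GA; have mA := gen_measurable sG GA.
have mXB k C : measurable C -> measurable (X k @^-1` C).
  by move=> mC; rewrite -[_ @^-1` _]setTI; exact: mX.
have [q [q' [Bq B'q' ->//]]] := cond_independent_pair ij mB mB'.
have [_ pi mp _] := Bp; have [_ qi mq _] := Bq; have [_ q'i mq' _] := B'q'.
have p2 : sqint P p.
  apply: sqint_ae_le1 (integrable_measurable pi) (cond_exp_indic_ae sG _ Bp).
  exact: mXB.
have q2 : sqint P q.
  apply: sqint_ae_le1 (integrable_measurable qi) (cond_exp_indic_ae sG _ Bq).
  exact: mXB.
have q'2 : sqint P q'.
  apply: sqint_ae_le1 (integrable_measurable q'i) (cond_exp_indic_ae sG _ B'q').
  exact: mXB.
have j2 : sqint P (\1_(X j @^-1` B')) by apply: sqint_indic; exact: mXB.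
transitivity (\int[P]_(w in A) (q' w * p w)); last first.
  rewrite -(cond_exp_pull_out sG B'q' j2 q'2 p2 mp GA).
  by apply: eq_Rintegral => w _; rewrite mulrC.
apply: ae_eq_Rintegral => //.
- exact: integrable_measurable (sqintM q2 q'2).
- exact: integrable_measurable (sqintM q'2 p2).
(* The versions in [cond_independent] depend on the chosen family of sets, so [q] and the given [p]
   have to be identified by their integrals. *)
have : {ae P, forall w, q w = p w}.
  apply: (ae_eq_gen sG) => // C GC.
  by rewrite -(cond_exp_Rintegral Bq GC) (cond_exp_Rintegral Bp GC).
by apply: filterS => w ->; rewrite mulrC.
Qed.

(* [gen_orthogonal] is used with respect to [G] and to the sigma-algebras
   generated by [X i] and by [X j]: it turns the product rule for indicators
   into the one for coordinates without approximating the latter. *)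
Lemma cond_independent_orthogonal A : <<s G >> A ->
  \int[P]_(w in A) ((X i w 0 a - Xh w) * (X j w 0 b - Yh w)) = 0.
Proof.
move=> GA; have mA := gen_measurable sG GA.
have mXB k C : measurable C -> measurable (X k @^-1` C).
  by move=> mC; rewrite -[_ @^-1` _]setTI; exact: mX.
have [_ _ mXh _] := XXh; have [_ _ mYh _] := YYh.
have D2 := sqintB Y2 Yh2.
pose V w := \1_A w * (X j w 0 b - Yh w).
have V2 : sqint P V by exact: sqint_indicM.
have VX : \int[P]_w (V w * X i w 0 a) = 0.
  apply: orthogonal_component => // B mB.
  have mi := mXB i B mB.
  have i2 := sqint_indic P mi.
  have [p Bp] := is_cond_exp_exists sG (sqintW i2).
  have [_ pi mp _] := Bp.
  have p2 : sqint P p.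
    by apply: sqint_ae_le1 (integrable_measurable pi) (cond_exp_indic_ae sG _ Bp).
  pose U w := \1_A w * (\1_(X i @^-1` B) w - p w).
  have U2 : sqint P U by apply: sqint_indicM => //; exact: sqintB.
  have UX : \int[P]_w (U w * X j w 0 b) = 0.
    apply: orthogonal_component => // B' mB'; have mj := mXB j B' mB'.
    have j2 := sqint_indic P mj.
    rewrite Rintegral_indicM.
    transitivity (\int[P]_(w in A) (\1_(X i @^-1` B) w * \1_(X j @^-1` B') w -
                                    p w * \1_(X j @^-1` B') w)).
      by rewrite [RHS]Rintegral_indicM; apply: eq_Rintegral => w _; rewrite /U; ring.
    rewrite RintegralBT//; [|exact: sqintM i2 j2|exact: sqintM p2 j2].
    by rewrite (indic_pull_out _ _ Bp GA)// subrr.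
  have iY : \int[P]_(w in A) (\1_(X i @^-1` B) w * X j w 0 b) =
            \int[P]_(w in A) (p w * X j w 0 b).
    apply/eqP; rewrite -subr_eq0 -RintegralBT//;
      [|exact: sqintM i2 Y2|exact: sqintM p2 Y2].
    rewrite -[X in _ == X]UX [X in X == _]Rintegral_indicM.
    apply/eqP/eq_Rintegral => w _.
    by rewrite /U; ring.
  (* With 1_B the indicator of the event on [X i], the integrals over [A] of 1_B X_j, p X_j, p Yh
     and 1_B Yh agree in this order: first by [iY], then by pulling out [p], then by pulling out
     [Yh]. *)
  have pY := cond_exp_pull_out sG YYh Y2 Yh2 p2 mp GA.
  have iYh := cond_exp_pull_out sG Bp i2 p2 Yh2 mYh GA.
  rewrite Rintegral_indicM.
  transitivity (\int[P]_(w in A) (\1_(X i @^-1` B) w * X j w 0 b -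
                                  \1_(X i @^-1` B) w * Yh w)).
    by rewrite [RHS]Rintegral_indicM; apply: eq_Rintegral => w _; rewrite /V; ring.
  rewrite RintegralBT//; [|exact: sqintM i2 Y2|exact: sqintM i2 Yh2].
  apply/eqP; rewrite subr_eq0 iY iYh; apply/eqP.
  under eq_Rintegral do rewrite mulrC; rewrite pY.
  by under eq_Rintegral do rewrite mulrC.
have VXh : \int[P]_(w in A) ((X j w 0 b - Yh w) * Xh w) = 0.
  apply/eqP; under eq_Rintegral do rewrite mulrBl.
  rewrite RintegralBT//; [|exact: sqintM Y2 Xh2|exact: sqintM Yh2 Xh2].
  by rewrite (cond_exp_pull_out sG YYh Y2 Yh2 Xh2 mXh GA) subrr.
transitivity (\int[P]_(w in A) ((X j w 0 b - Yh w) * X i w 0 a -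
                                (X j w 0 b - Yh w) * Xh w)).
  by apply: eq_Rintegral => w _; ring.
rewrite RintegralBT//; [|exact: sqintM D2 X2|exact: sqintM D2 Xh2].
rewrite VXh subr0 Rintegral_indicM -[RHS]VX.
by apply: eq_Rintegral => w _; rewrite /V mulrA.
Qed.

End cond_independence.

(** * Compression *)

Section euclidean.
Context {R : realType} {d : nat}.
Implicit Types u v : 'rV[R]_d.

Lemma dotpC u v : dotp u v = dotp v u.
Proof. by apply: eq_bigr => j _; rewrite mulrC. Qed.

Lemma dotpDl u v w : dotp (u + v) w = dotp u w + dotp v w.
Proof. by rewrite -big_split; apply: eq_bigr => j _; rewrite mxE mulrDl. Qed.

Lemma dotpDr u v w : dotp u (v + w) = dotp u v + dotp u w.
Proof. by rewrite dotpC dotpDl !(dotpC u). Qed.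

Lemma dotpZl c u v : dotp (c *: u) v = c * dotp u v.
Proof. by rewrite mulr_sumr; apply: eq_bigr => j _; rewrite mxE mulrA. Qed.

Lemma dotpZr c u v : dotp u (c *: v) = c * dotp u v.
Proof. by rewrite dotpC dotpZl dotpC. Qed.

Lemma dotpNl u v : dotp (- u) v = - dotp u v.
Proof. by rewrite -scaleN1r dotpZl mulN1r. Qed.

Lemma dotpNr u v : dotp u (- v) = - dotp u v.
Proof. by rewrite dotpC dotpNl dotpC. Qed.

Definition dotpE := (dotpDl, dotpDr, dotpZl, dotpZr, dotpNl, dotpNr).

Lemma dotp_suml (I : Type) (s : seq I) (u : I -> 'rV[R]_d) v :
  dotp (\sum_(i <- s) u i) v = \sum_(i <- s) dotp (u i) v.
Proof.
elim: s => [|i s ih]; last by rewrite !big_cons dotpDl ih.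
by rewrite !big_nil -(scale0r 0) dotpZl mul0r.
Qed.

Lemma dotp_ge0 u : 0 <= dotp u u.
Proof. by apply: sumr_ge0 => j _; rewrite -expr2 sqr_ge0. Qed.

Lemma sqr_norm2 u : norm2 u ^+ 2 = dotp u u.
Proof. by rewrite sqr_sqrtr// dotp_ge0. Qed.

Lemma sqr_coord_le u j : u 0 j ^+ 2 <= dotp u u.
Proof.
rewrite /dotp (bigD1 j)//= -expr2 lerDl.
by apply: sumr_ge0 => i _; rewrite -expr2 sqr_ge0.
Qed.

Lemma measurable_dotp dX (X : measurableType dX) (u v : X -> 'rV[R]_d) :
  measurable_fun setT u -> measurable_fun setT v ->
  measurable_fun setT (fun x => dotp (u x) (v x)).
Proof.
move=> mu mv; apply: measurable_sum => j.
by apply: measurable_funM; apply: (measurableT_comp (measurable_coord j)).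
Qed.

Lemma measurable_rVP dX (X : measurableType dX) (u : X -> 'rV[R]_d) :
  measurable_fun setT u <-> forall j, measurable_fun setT (fun x => u x 0 j).
Proof.
split=> [mu j|mu]; first exact: (measurableT_comp (measurable_coord j)).
pose coord (j : 'I_d) (v : 'rV[R]_d) : measurableTypeR R := v 0 j.
apply: (measurability (\big[setU/set0]_(j < d)
  preimage_set_system setT (coord j) measurable)) => //.
rewrite -bigcup_seq => _ [_ [j _ [B mB <-]] <-].
by rewrite !setTI; have := mu j measurableT B mB; rewrite setTI.
Qed.

End euclidean.

Section probability_of_measure.
Context dT (T : measurableType dT) (R : realType).
Variables (mu : {measure set T -> \bar R}) (mu1 : mu setT = 1%E).

(* The proof argument lets the probability structure be inferred. *)
Definition total_mass1 of mu setT = 1%E : set T -> \bar R := mu.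

HB.instance Definition _ := Measure.on (total_mass1 mu1).

HB.instance Definition _ :=
  Measure_isProbability.Build _ _ _ (total_mass1 mu1) mu1.

End probability_of_measure.

Section second_moment.
Context (R : realType) (d : nat) (mu : probability 'rV[R]_d R).

(** Bias-variance decomposition: |y|^2 = |y - x|^2 + 2<x, y> - |x|^2 is integrated, and <x, y> has
    mean |x|^2. The inner product is kept as a sum over coordinates because the mean is given
    coordinatewise. *)
Lemma second_moment_le (x : 'rV[R]_d) (c : R) :
  (forall j, mu.-integrable setT (fun y : 'rV[R]_d => (y 0 j)%:E) /\
    (\int[mu]_y (y 0 j)%:E = (x 0 j)%:E)%E) ->
  (\int[mu]_y (dotp (y - x) (y - x))%:E <= c%:E)%E ->
  (\int[mu]_y (dotp y y)%:E <= (c + dotp x x)%:E)%E.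
Proof.
move=> mean var.
have mid : measurable_fun setT (id : 'rV[R]_d -> 'rV[R]_d) by [].
have mB : measurable_fun setT (fun y : 'rV[R]_d => y - x).
  apply/measurable_rVP => j; under eq_fun do rewrite mxE.
  by apply: measurable_funD => //; exact: measurable_coord.
have vi : mu.-integrable setT (EFin \o (fun y : 'rV[R]_d => dotp (y - x) (y - x))).
  apply: ge0_integrable_fin; first exact: measurable_dotp.
  - by move=> y; exact: dotp_ge0.
  - exact: le_lt_trans var (ltry _).
have ci : mu.-integrable setT
    (EFin \o (fun y : 'rV[R]_d => \sum_j (2 * x 0 j) * y 0 j)).
  by apply: integrable_sumR => j; apply: integrableZR; exact: (mean j).1.
have xi : mu.-integrable setT (EFin \o (fun=> dotp x x)) by exact: integrable_cstR.
have ce : \int[mu]_y (\sum_j (2 * x 0 j) * y 0 j) = 2 * dotp x x.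
  rewrite Rintegral_sumT//; last by move=> j; exact: integrableZR (mean j).1.
  rewrite /dotp mulr_sumr; apply: eq_bigr => j _.
  rewrite RintegralZT//; last exact: (mean j).1.
  by rewrite /Rintegral (mean j).2 mulrA.
have yE y : dotp y y = dotp (y - x) (y - x) + (\sum_j (2 * x 0 j) * y 0 j - dotp x x).
  under eq_bigr do rewrite -mulrA.
  rewrite -mulr_sumr -[\sum_j _]/(dotp x y) !dotpE (dotpC y x); ring.
under eq_integral do rewrite yE.
have bi := integrableBR ci xi.
rewrite -(RintegralM measurableT (integrableDR vi bi)) lee_fin RintegralDT//.
rewrite RintegralBT// ce Rintegral_cstT.
have : \int[mu]_y dotp (y - x) (y - x) <= c.
  by rewrite -lee_fin RintegralM.
by lra.
Qed.

End second_moment.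

Section conditional_law.
Context dT (T : measurableType dT) (R : realType) (P : probability T R).
Variables (J : set (set T)) (sJ : J `<=` measurable) (d : nat).
Variables (Q : R.-pker ('rV[R]_d) ~> ('rV[R]_d)) (D q : T -> 'rV[R]_d).
Hypotheses (mD : measurable_fun [set: g_sigma_algebraType J] D)
  (mq : measurable_fun setT q) (lawq : has_cond_law P J Q D q).

(** [f (q w)] is the integral of [f] against the Dirac mass at [q w], and [has_cond_law] says that
    these masses and the laws [Q (D w)] have equal mixtures over every event of [<<s J >>]. *)
Lemma cond_law_integral A (f : 'rV[R]_d -> \bar R) : <<s J >> A ->
  measurable_fun setT f -> (forall y, 0 <= f y)%E ->
  (\int[P]_(w in A) f (q w) = \int[P]_(w in A) \int[Q (D w)]_y f y)%E.
Proof.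
move=> JA mf f0; have mA := gen_measurable sJ JA.
have mDT := gen_measurable_fun sJ mD.
transitivity (\int[P]_(w in A) \int[\d_(q w)]_y f y)%E.
  by apply: eq_integral => w _; rewrite integral_dirac// diracT mul1e.
apply: (@eq_kernel_integral _ _ _ _ _ P A mA (fun w => \d_(q w))
  (fun w => Q (D w))) => //.
- move=> B mB; apply/measurable_EFinP/measurable_funTS.
  by apply: (measurableT_comp (measurable_indic _)).
- move=> B mB; apply: measurable_funTS.
  exact: measurableT_comp (measurable_kernel Q B mB) mDT.
- move=> B mB; have [_ _ _ /(_ A JA) BE] := lawq mB.
  transitivity (\int[P]_(w in A) (\1_(q @^-1` B) w)%:E)%E.
    by apply: eq_integral => w _; rewrite /= diracE indicE.
  rewrite BE; apply: eq_integral => w _; rewrite fineK//.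
  rewrite ge0_fin_numE//; apply: (@le_lt_trans _ _ 1%E); last exact: ltry.
  by rewrite -(prob_kernel (s := Q) (D w)); apply: le_measure; rewrite ?inE.
Qed.

Variable omega : R.
Hypotheses (D2 : forall j, sqint P (fun w => D w 0 j))
  (Qomega : unbiased_compressor omega Q).

Lemma compressor_second_moment x :
  (\int[Q x]_y (dotp y y)%:E <= ((1 + omega) * dotp x x)%:E)%E.
Proof.
have [mean var] := Qomega x.
pose Qx : probability 'rV[R]_d R := total_mass1 (prob_kernel (s := Q) x).
rewrite mulrDl mul1r addrC; apply: (@second_moment_le _ _ Qx) => //.
by under eq_integral do rewrite -sqr_norm2; rewrite -sqr_norm2.
Qed.

Let mDT : measurable_fun setT D := gen_measurable_fun sJ mD.

Let mqj j : measurable_fun setT (fun w => q w 0 j).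
Proof. exact: (measurableT_comp (measurable_coord j)). Qed.

Let mdotp : measurable_fun setT (fun y : 'rV[R]_d => (dotp y y)%:E).
Proof. by apply/measurable_EFinP; exact: measurable_dotp. Qed.

Lemma sqint_dotp (u v : T -> 'rV[R]_d) :
  (forall j, sqint P (fun w => u w 0 j)) ->
  (forall j, sqint P (fun w => v w 0 j)) ->
  P.-integrable setT (EFin \o (fun w => dotp (u w) (v w))).
Proof. by move=> u2 v2; apply: integrable_sumR => j; exact: sqintM. Qed.

(** The left side stays in the extended reals: with [A] the whole space, this bound is what proves
    [q] square integrable. *)
Lemma cond_law_second_moment_le A : <<s J >> A ->
  (\int[P]_(w in A) (dotp (q w) (q w))%:E <=
   (\int[P]_(w in A) ((1 + omega) * dotp (D w) (D w)))%:E)%E.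
Proof.
move=> JA; have mA := gen_measurable sJ JA.
have Di := integrableZR (1 + omega) (sqint_dotp D2 D2).
rewrite RintegralM// (cond_law_integral JA mdotp); last first.
  by move=> y; rewrite lee_fin dotp_ge0.
apply: ge0_le_integral => //.
- by move=> w _; apply: integral_ge0 => y _; rewrite lee_fin dotp_ge0.
- apply: measurable_funTS.
  have mI := measurable_fun_integral_kernel (measurable_kernel Q)
    (fun y => dotp_ge0 y : (0 <= (dotp y y)%:E)%E) mdotp.
  exact: measurableT_comp mI mDT.
- by apply: measurable_funTS; exact: measurable_int Di.
- by move=> w _; exact: compressor_second_moment.
Qed.

Lemma cond_law_sqint j : sqint P (fun w => q w 0 j).
Proof.
split => //; apply: (le_integrableR (g := fun w => dotp (q w) (q w))).
- exact: measurable_funX.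
- by move=> w; rewrite ger0_norm ?sqr_ge0// sqr_coord_le.
- apply: ge0_integrable_fin; first exact: measurable_dotp.
  + by move=> w; exact: dotp_ge0.
  + have JT : <<s J >> setT := @measurableT _ (g_sigma_algebraType J).
    exact: le_lt_trans (cond_law_second_moment_le JT) (ltry _).
Qed.

(** [cond_law_integral] covers nonnegative functions only, so the coordinate is split into its
    positive and negative parts. Both are dominated by its absolute value, which makes their means
    under [Q (D w)] finite and integrable. *)
Lemma cond_law_mean j : is_cond_exp P J (fun w => q w 0 j) (fun w => D w 0 j).
Proof.
have q2 := cond_law_sqint j; have qi := sqintW q2.
apply: is_cond_expP => //; first exact: sqintW (D2 j).
  exact: measurableT_comp (measurable_coord j) mD.
move=> A JA; have mA := gen_measurable sJ JA.
pose c (y : 'rV[R]_d) : R := y 0 j.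
have mc : measurable_fun setT c by exact: measurable_coord.
(* [m f w] is the mean of [f] under the law [Q (D w)]. *)
pose m (f : 'rV[R]_d -> R) w := fine (\int[Q (D w)]_y (f y)%:E)%E.
have mE (f : 'rV[R]_d -> R) :
    measurable_fun setT f -> (forall y, 0 <= f y <= `|c y|) ->
    P.-integrable setT (EFin \o m f) /\
    \int[P]_(w in A) f (q w) = \int[P]_(w in A) m f w.
  move=> mf f0.
  have mfE : measurable_fun setT (EFin \o f) by exact/measurable_EFinP.
  have fE0 y : (0 <= (EFin \o f) y)%E by rewrite lee_fin; case/andP: (f0 y).
  have ffin w : (m f w)%:E = (\int[Q (D w)]_y (f y)%:E)%E.
    have [/(_ j)[ci _] _] := Qomega (D w).
    rewrite fineK//; apply: integrable_fin_num => //.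
    apply: le_integrable ci => //.
    by move=> y _ /=; rewrite lee_fin ger0_norm; case/andP: (f0 y).
  have IE B : <<s J >> B ->
      (\int[P]_(w in B) (f (q w))%:E = \int[P]_(w in B) (m f w)%:E)%E.
    move=> JB; rewrite (cond_law_integral JB mfE fE0).
    by apply: eq_integral => w _; rewrite ffin.
  split; last by rewrite /Rintegral IE.
  apply: ge0_integrable_fin.
  - have mI := measurable_fun_integral_kernel (measurable_kernel Q) fE0 mfE.
    exact: measurableT_comp (measurableT_comp mI mDT).
  - by move=> w; apply: fine_ge0; apply: integral_ge0 => y _; exact: fE0.
  - have JT : <<s J >> setT := @measurableT _ (g_sigma_algebraType J).
    rewrite -IE//; have /integrableP[_] := qi; apply: le_lt_trans.
    apply: ge0_le_integral => //.
    + by move=> w _; exact: fE0.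
    + exact: measurableT_comp mfE mq.
    + by apply: measurableT_comp => //; exact/measurable_EFinP.
    + by move=> w _ /=; rewrite lee_fin; case/andP: (f0 (q w)).
have cle y : (0 <= c^\+ y <= `|c y|) /\ (0 <= c^\- y <= `|c y|).
  rewrite -[`|c y|]/((Num.norm \o c) y) -funrposDneg.
  by split; apply/andP; split; rewrite ?lerDl ?lerDr.
have [pi pE] := mE _ (measurable_funrpos mc) (fun y => (cle y).1).
have [ni nE] := mE _ (measurable_funrneg mc) (fun y => (cle y).2).
transitivity (\int[P]_(w in A) (c^\+ (q w) - c^\- (q w))).
  apply: eq_Rintegral => w _.
  by rewrite -[q w 0 j]/(c (q w)) -[in LHS](funrposBneg c).
have qle (f : 'rV[R]_d -> R) :
    measurable_fun setT f -> (forall y, 0 <= f y <= `|c y|) ->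
    P.-integrable setT (EFin \o (fun w => f (q w))).
  move=> mf f0; apply: le_integrableR (integrable_norm qi).
    exact: measurableT_comp mf mq.
  by move=> w /=; have /andP[f1 f2] := f0 (q w); rewrite ger0_norm.
rewrite RintegralBT//; last 2 first.
- by apply: qle => [|y]; [exact: measurable_funrpos|exact: (cle y).1].
- by apply: qle => [|y]; [exact: measurable_funrneg|exact: (cle y).2].
rewrite pE nE -RintegralBT//; apply: eq_Rintegral => w _.
have [/(_ j)[ci cE] _] := Qomega (D w).
have := integralE (Q (D w)) setT (EFin \o c).
have -> : (\int[Q (D w)]_y (EFin \o c) y)%E = (D w 0 j)%:E by [].
rewrite /m.
have pf := integrable_pos_fin_num measurableT ci.
have nf := integrable_neg_fin_num measurableT ci.
by rewrite funerpos funerneg in pf nf *; rewrite -fineB// => <-.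
Qed.

End conditional_law.

(** * Vector-valued random variables *)

Section inner_product.
Context dT (T : measurableType dT) (R : realType) (P : probability T R) (d : nat).
Implicit Types (u v s : T -> 'rV[R]_d) (A : set T).

Definition sqint_rV u : Prop := forall j, sqint P (fun w => u w 0 j).

Definition ip A u v : R := \int[P]_(w in A) dotp (u w) (v w).

Lemma sqint_rV_cst c : sqint_rV (fun=> c).
Proof. by move=> j; exact: sqint_cst. Qed.

Lemma sqint_rVD u v : sqint_rV u -> sqint_rV v -> sqint_rV (fun w => u w + v w).
Proof. by move=> u2 v2 j; under eq_fun do rewrite mxE; exact: sqintD. Qed.

Lemma sqint_rVZ c u : sqint_rV u -> sqint_rV (fun w => c *: u w).
Proof. by move=> u2 j; under eq_fun do rewrite mxE; exact: sqintZ. Qed.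

Lemma sqint_rVB u v : sqint_rV u -> sqint_rV v -> sqint_rV (fun w => u w - v w).
Proof. by move=> u2 v2 j; under eq_fun do rewrite !mxE; exact: sqintB. Qed.

Lemma sqint_rV_average n (u : 'I_n -> T -> 'rV[R]_d) :
  (forall i, sqint_rV (u i)) -> sqint_rV (fun w => average (u ^~ w)).
Proof.
move=> u2; apply: sqint_rVZ => j; under eq_fun do rewrite summxE.
by apply: sqint_sum => i; exact: u2.
Qed.

Lemma sqint_rV_measurable u : sqint_rV u -> measurable_fun setT u.
Proof. by move=> u2; apply/measurable_rVP => j; have [] := u2 j. Qed.

Lemma ipC A u v : ip A u v = ip A v u.
Proof. by apply: eq_Rintegral => w _; exact: dotpC. Qed.

Lemma ip_sum A u v : measurable A -> sqint_rV u -> sqint_rV v ->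
  ip A u v = \sum_j \int[P]_(w in A) (u w 0 j * v w 0 j).
Proof. by move=> mA u2 v2; rewrite /ip Rintegral_sumT// => j; exact: sqintM. Qed.

Lemma ipDl A u v s : measurable A -> sqint_rV u -> sqint_rV v -> sqint_rV s ->
  ip A (fun w => u w + v w) s = ip A u s + ip A v s.
Proof.
move=> mA u2 v2 s2; rewrite /ip; under eq_Rintegral do rewrite dotpDl.
by rewrite RintegralDT//; exact: sqint_dotp.
Qed.

Lemma ipZl A c u v : measurable A -> sqint_rV u -> sqint_rV v ->
  ip A (fun w => c *: u w) v = c * ip A u v.
Proof.
move=> mA u2 v2; rewrite /ip; under eq_Rintegral do rewrite dotpZl.
by rewrite RintegralZT//; exact: sqint_dotp.
Qed.

Lemma ipBl A u v s : measurable A -> sqint_rV u -> sqint_rV v -> sqint_rV s ->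
  ip A (fun w => u w - v w) s = ip A u s - ip A v s.
Proof.
move=> mA u2 v2 s2; rewrite /ip.
under eq_Rintegral do rewrite dotpDl dotpNl.
by rewrite RintegralBT//; exact: sqint_dotp.
Qed.

Lemma ip_averagel A n (u : 'I_n -> T -> 'rV[R]_d) v : measurable A ->
  (forall i, sqint_rV (u i)) -> sqint_rV v ->
  ip A (fun w => average (u ^~ w)) v = n%:R^-1 * \sum_i ip A (u i) v.
Proof.
move=> mA u2 v2.
have uv i : P.-integrable setT (EFin \o (fun w => dotp (u i w) (v w))).
  exact: (sqint_dotp (u2 i) v2).
rewrite -Rintegral_sumT// -RintegralZT//; last exact: integrable_sumR.
apply: eq_Rintegral => w _; rewrite /average dotpZl; congr (_ * _).
exact: dotp_suml.
Qed.

Lemma ip_ge0 A u : 0 <= ip A u u.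
Proof. by apply: Rintegral_ge0 => w _; exact: dotp_ge0. Qed.

Lemma ip_sqrD A u v : measurable A -> sqint_rV u -> sqint_rV v ->
  ip A (fun w => u w + v w) (fun w => u w + v w) =
  ip A u u + 2 * ip A u v + ip A v v.
Proof.
move=> mA u2 v2; have uv2 := sqint_rVD u2 v2.
rewrite ipDl// (ipC A u) (ipC A v) !ipDl// (ipC A v u); ring.
Qed.

Lemma ip_sqrB A u v : measurable A -> sqint_rV u -> sqint_rV v ->
  ip A (fun w => u w - v w) (fun w => u w - v w) =
  ip A u u - 2 * ip A u v + ip A v v.
Proof.
move=> mA u2 v2; have uv2 := sqint_rVB u2 v2.
rewrite ipBl// (ipC A u) (ipC A v) !ipBl// (ipC A v u); ring.
Qed.

(** Only the diagonal terms survive: this is the source of the gain [1 / n] in [B] and [D1]. *)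
Lemma ip_sqr_average A n (u : 'I_n -> T -> 'rV[R]_d) : measurable A ->
  (forall i, sqint_rV (u i)) ->
  (forall i j, i != j -> ip A (u i) (u j) = 0) ->
  ip A (fun w => average (u ^~ w)) (fun w => average (u ^~ w)) =
  n%:R^-1 * (n%:R^-1 * \sum_i ip A (u i) (u i)).
Proof.
move=> mA u2 u0; have a2 := sqint_rV_average u2.
rewrite ip_averagel//; congr (_ * _); rewrite mulr_sumr; apply: eq_bigr => i _.
rewrite ipC ip_averagel//; congr (_ * _).
by rewrite (bigD1 i)//= big1 ?addr0// => j ji; rewrite u0.
Qed.

End inner_product.

Section conditional_inner_product.
Context dT (T : measurableType dT) (R : realType) (P : probability T R).
Variables (G : set (set T)) (sG : G `<=` measurable) (d : nat).
Implicit Types (X Y S : T -> 'rV[R]_d) (A : set T).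

Lemma cond_exp_ip0 X Y S A : is_cond_exp_rV P G X Y ->
  sqint_rV P X -> sqint_rV P Y -> sqint_rV P S ->
  measurable_fun [set: g_sigma_algebraType G] S -> <<s G >> A ->
  ip P A (fun w => X w - Y w) S = 0.
Proof.
move=> XY X2 Y2 S2 /measurable_rVP mS GA; have mA := gen_measurable sG GA.
rewrite ipBl// !ip_sum// -sumrB big1// => j _.
by rewrite (cond_exp_pull_out sG (XY j) (X2 j) (Y2 j) (S2 j) (mS j) GA) subrr.
Qed.

Lemma cond_independent_ip0 n (X Y : 'I_n -> T -> 'rV[R]_d) i j A :
  cond_independent P G X -> (forall k, is_cond_exp_rV P G (X k) (Y k)) ->
  (forall k, sqint_rV P (X k)) -> (forall k, sqint_rV P (Y k)) ->
  i != j -> <<s G >> A ->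
  ip P A (fun w => X i w - Y i w) (fun w => X j w - Y j w) = 0.
Proof.
move=> Xind XY X2 Y2 ij GA; have mA := gen_measurable sG GA.
rewrite ip_sum//; [|exact: sqint_rVB..].
apply: big1 => a _; under eq_Rintegral do rewrite !mxE.
apply: (cond_independent_orthogonal sG _ Xind ij (X2 i a) (X2 j a)) => //.
- by move=> k; exact: sqint_rV_measurable.
- exact: Y2.
- exact: Y2.
- exact: XY.
- exact: XY.
Qed.

End conditional_inner_product.

(** * One iteration *)

Section average.
Context {R : realType} {d n : nat}.
Implicit Types u v : 'I_n -> 'rV[R]_d.

Lemma averageD u v : average (fun i => u i + v i) = average u + average v.
Proof. by rewrite /average big_split scalerDr. Qed.

Lemma averageB u v : average (fun i => u i - v i) = average u - average v.
Proof. by rewrite /average sumrB scalerBr. Qed.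

Lemma averageZ c u : average (fun i => c *: u i) = c *: average u.
Proof. by rewrite /average -scaler_sumr !scalerA mulrC. Qed.

(** Jensen's inequality, from expanding the nonnegative mean of the |u_i - a|^2 around the average
    [a]. *)
Lemma dotp_average_le u : (0 < n)%N ->
  dotp (average u) (average u) <= n%:R^-1 * \sum_i dotp (u i) (u i).
Proof.
move=> n0; have nR : 0 < n%:R :> R by rewrite ltr0n.
set a := average u.
have : 0 <= n%:R^-1 * \sum_i dotp (u i - a) (u i - a).
  by rewrite mulr_ge0 ?invr_ge0 ?ler0n// sumr_ge0// => i _; exact: dotp_ge0.
have -> : \sum_i dotp (u i - a) (u i - a) =
    \sum_i dotp (u i) (u i) - 2 * \sum_i dotp (u i) a + n%:R * dotp a a.
  rewrite (eq_bigr (fun i => dotp (u i) (u i) - 2 * dotp (u i) a + dotp a a)).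
    by rewrite big_split /= sumrB -mulr_sumr sumr_const card_ord [n%:R * _]mulr_natl.
  by move=> i _; move: a => a; rewrite !dotpE (dotpC a (u i)); ring.
have -> : \sum_i dotp (u i) a = n%:R * dotp a a.
  by rewrite -dotp_suml {2}/a /average dotpZl mulrA mulfV ?mul1r ?gt_eqF.
rewrite !mulrDr mulrN (mulrCA _ 2) !(mulrA n%:R^-1) mulVf ?gt_eqF// mul1r; lra.
Qed.

End average.

Lemma measurable_average dX (X : measurableType dX) (R : realType) (d n : nat)
    (u : 'I_n -> X -> 'rV[R]_d) :
  (forall i, measurable_fun setT (u i)) ->
  measurable_fun setT (fun w => average (u ^~ w)).
Proof.
move=> mu; apply/measurable_rVP => j; under eq_fun do rewrite mxE summxE.
apply: measurable_funM => //; apply: measurable_sum => i.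
by have /measurable_rVP := mu i.
Qed.

Section compressed_step.
Context dT (T : measurableType dT) (R : realType) (P : probability T R).
Variables (G : set (set T)) (sG : G `<=` measurable) (d n : nat).
Variables (h gi q Fx : 'I_n -> T -> 'rV[R]_d) (Fs : 'I_n -> 'rV[R]_d).
Hypotheses (h2 : forall i, sqint_rV P (h i))
  (Fx2 : forall i, sqint_rV P (Fx i)) (gi2 : forall i, sqint_rV P (gi i))
  (mh : forall i, measurable_fun [set: g_sigma_algebraType G] (h i))
  (mq : forall i, measurable_fun setT (q i))
  (gi_mean : forall i, is_cond_exp_rV P G (gi i) (Fx i))
  (gi_indep : cond_independent P G gi).

Let J := joint_info G gi.

Variables (omega : R) (omega0 : 0 <= omega)
  (Q : R.-pker ('rV[R]_d) ~> ('rV[R]_d)) (Qomega : unbiased_compressor omega Q).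
Hypotheses
  (q_law : forall i, has_cond_law P J Q (fun w => gi i w - h i w) (q i))
  (q_indep : cond_independent P J q).

Let D i w : 'rV[R]_d := gi i w - h i w.
Let U i w : 'rV[R]_d := q i w - D i w.
Let V i w : 'rV[R]_d := gi i w - Fx i w.

Lemma joint_info_measurable : J `<=` measurable.
Proof.
move=> A [/sG//|[i _ [B mB <-]]].
exact: (sqint_rV_measurable (gi2 i)).
Qed.
Let sJ := joint_info_measurable.

Let sGJ : <<s G >> `<=` <<s J >>.
Proof. by apply: sub_sigma_algebra2 => A GA; left. Qed.

Let mGJ d' (Y : measurableType d') (f : T -> Y) :
  measurable_fun [set: g_sigma_algebraType G] f ->
  measurable_fun [set: g_sigma_algebraType J] f.
Proof. by move=> mf mT B mB; apply: sGJ; exact: mf. Qed.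

Let mFx i : measurable_fun [set: g_sigma_algebraType G] (Fx i).
Proof. by apply/measurable_rVP => j; have [] := gi_mean i j. Qed.

Let mgi i : measurable_fun [set: g_sigma_algebraType J] (gi i).
Proof.
move=> _ B mB; apply: sub_sigma_algebra; right; exists i => //.
by exists B.
Qed.

Let mB H (u v : T -> 'rV[R]_d) :
  measurable_fun [set: g_sigma_algebraType H] u ->
  measurable_fun [set: g_sigma_algebraType H] v ->
  measurable_fun [set: g_sigma_algebraType H] (fun w => u w - v w).
Proof.
move=> /measurable_rVP mu /measurable_rVP mv; apply/measurable_rVP => j.
by under eq_fun do rewrite !mxE; exact: measurable_funB.
Qed.

Let D2 i : sqint_rV P (D i). Proof. exact: sqint_rVB. Qed.
Let mD i : measurable_fun [set: g_sigma_algebraType J] (D i).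
Proof. by apply: mB => //; exact: mGJ. Qed.
Let V2 i : sqint_rV P (V i). Proof. exact: sqint_rVB. Qed.

Lemma compressed_sqint i : sqint_rV P (q i).
Proof.
by move=> j; apply: (cond_law_sqint sJ (mD i) (mq i) (q_law i) (D2 i) Qomega).
Qed.
Let q2 := compressed_sqint.
Let U2 i : sqint_rV P (U i). Proof. exact: sqint_rVB. Qed.

Lemma compressed_mean i : is_cond_exp_rV P J (q i) (D i).
Proof.
by move=> j; apply: (cond_law_mean sJ (mD i) (mq i) (q_law i) (D2 i) Qomega).
Qed.

Let ipU0 i S A : sqint_rV P S -> measurable_fun [set: g_sigma_algebraType J] S ->
  <<s J >> A -> ip P A (U i) S = 0.
Proof. by move=> S2 mS JA; apply: (cond_exp_ip0 sJ (compressed_mean i)). Qed.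

Let ipV0 i S A : sqint_rV P S -> measurable_fun [set: g_sigma_algebraType G] S ->
  <<s G >> A -> ip P A (V i) S = 0.
Proof. by move=> S2 mS GA; apply: (cond_exp_ip0 sG (gi_mean i)). Qed.

(** The law of [q i] is transferred for functions of [q i] alone, whereas [U i] also involves [D i].
    So the second moment of [q i], at most [1 + omega] times that of [D i], is used; [U i] being
    orthogonal to [D i], expanding the square subtracts exactly one second moment of [D i]. *)
Let ipU_le i A : <<s J >> A -> ip P A (U i) (U i) <= omega * ip P A (D i) (D i).
Proof.
move=> JA; have mA := gen_measurable sJ JA.
rewrite ip_sqrB//.
have : ip P A (q i) (D i) - ip P A (D i) (D i) = 0 by rewrite -ipBl// ipU0.
have : ip P A (q i) (q i) <= (1 + omega) * ip P A (D i) (D i).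
  have qi := sqint_dotp (q2 i) (q2 i); have Di := sqint_dotp (D2 i) (D2 i).
  rewrite -[X in _ <= X]RintegralZT// -lee_fin /ip RintegralM//.
  exact: (cond_law_second_moment_le sJ (mD i) (mq i) (q_law i) (D2 i) Qomega).
by lra.
Qed.

Let cst_measurable (H : set (set T)) (c : 'rV[R]_d) :
  measurable_fun [set: g_sigma_algebraType H] (fun _ : T => c).
Proof. exact: measurable_cst. Qed.

(** With a = F_i(x) - Fs_i and b = h_i - Fs_i, D_i = V_i + (a - b), where V_i is orthogonal to a -
    b, which is known from the past. Then |a - b|^2 is at most 2|a|^2 + 2|b|^2, the difference being
    |a + b|^2. *)
Let ipD_le i A : <<s G >> A ->
  ip P A (D i) (D i) <= ip P A (V i) (V i)
    + 2 * ip P A (fun w => Fx i w - Fs i) (fun w => Fx i w - Fs i)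
    + 2 * ip P A (fun w => h i w - Fs i) (fun w => h i w - Fs i).
Proof.
move=> GA; have mA := gen_measurable sG GA.
pose a w := Fx i w - Fs i; pose b w := h i w - Fs i.
have a2 : sqint_rV P a by apply: sqint_rVB => //; exact: sqint_rV_cst.
have b2 : sqint_rV P b by apply: sqint_rVB => //; exact: sqint_rV_cst.
have ab2 := sqint_rVB a2 b2.
have mab : measurable_fun [set: g_sigma_algebraType G] (fun w => a w - b w).
  by apply: mB; apply: mB => //; exact: cst_measurable.
have -> : D i = (fun w => V i w + (a w - b w)).
  by apply/funext => w; apply/rowP => j; rewrite /D /V /a /b !mxE; ring.
rewrite ip_sqrD// [X in 2 * X]ipV0// mulr0 addr0 -addrA lerD2l.
have := ip_ge0 P A (fun w => a w + b w).
rewrite ip_sqrD// ip_sqrB// -/a -/b; lra.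
Qed.

Let mean (f : 'I_n -> R) : R := n%:R^-1 * \sum_i f i.

Variable n_gt0 : (0 < n)%N.
Let nR : 0 < n%:R^-1 :> R. Proof. by rewrite invr_gt0 ltr0n. Qed.

Let le_mean f g : (forall i, f i <= g i) -> mean f <= mean g.
Proof. by move=> fg; rewrite ler_pM2l// ler_sum. Qed.

Let meanD f g : mean (fun i => f i + g i) = mean f + mean g.
Proof. by rewrite /mean big_split mulrDr. Qed.

Let meanZ c f : mean (fun i => c * f i) = c * mean f.
Proof. by rewrite /mean -mulr_sumr mulrCA. Qed.

Let g_err w : 'rV[R]_d := average (h ^~ w) + average (q ^~ w) - average Fs.

Lemma compressed_average_le A : <<s G >> A ->
  ip P A g_err g_err <= n%:R^-1 *
    ((1 + omega) * (n%:R^-1 * \sum_i ip P A (V i) (V i))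
     + 2 * omega * (n%:R^-1 * \sum_i
         ip P A (fun w => Fx i w - Fs i) (fun w => Fx i w - Fs i))
     + 2 * omega * (n%:R^-1 * \sum_i
         ip P A (fun w => h i w - Fs i) (fun w => h i w - Fs i)))
    + n%:R^-1 * \sum_i ip P A (fun w => Fx i w - Fs i) (fun w => Fx i w - Fs i).
Proof.
move=> GA; have mA := gen_measurable sG GA; have JA := sGJ GA.
pose a i w := Fx i w - Fs i; pose b i w := h i w - Fs i.
rewrite -!/(mean _).
have a2 i : sqint_rV P (a i) by apply: sqint_rVB => //; exact: sqint_rV_cst.
pose W w := average (a ^~ w).
have W2 : sqint_rV P W := sqint_rV_average a2.
have mW : measurable_fun [set: g_sigma_algebraType G] W.
  by apply: measurable_average => i; apply: mB => //; exact: cst_measurable.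
pose Ub w := average (U ^~ w); pose Vb w := average (V ^~ w).
have Ub2 : sqint_rV P Ub := sqint_rV_average U2.
have Vb2 : sqint_rV P Vb := sqint_rV_average V2.
have UVb2 := sqint_rVD Ub2 Vb2.
have mVb : measurable_fun [set: g_sigma_algebraType J] Vb.
  by apply: measurable_average => i; apply: mB => //; exact: mGJ.
have UW : ip P A Ub W = 0.
  by rewrite ip_averagel// big1 ?mulr0// => i _; rewrite ipU0//; exact: mGJ.
have UV : ip P A Ub Vb = 0.
  by rewrite ip_averagel// big1 ?mulr0// => i _; rewrite ipU0.
have VW : ip P A Vb W = 0.
  by rewrite ip_averagel// big1 ?mulr0// => i _; rewrite ipV0.
have UU : ip P A Ub Ub = n%:R^-1 * mean (fun i => ip P A (U i) (U i)).
  rewrite ip_sqr_average// => i j ij.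
  by apply: (cond_independent_ip0 sJ q_indep compressed_mean).
have VV : ip P A Vb Vb = n%:R^-1 * mean (fun i => ip P A (V i) (V i)).
  rewrite ip_sqr_average// => i j ij.
  by apply: (cond_independent_ip0 sG gi_indep gi_mean).
have -> : g_err = (fun w => Ub w + Vb w + W w).
  apply/funext => w; rewrite /g_err /Ub /Vb /W /U /V /D /a -!averageD -averageB.
  congr average; apply/funext => i; apply/rowP => j; rewrite !mxE; ring.
rewrite ip_sqrD// ip_sqrD// ipDl// UV UW VW UU VV.
(* [W] is known from the past and not centered: its cross terms do not cancel, and convexity bounds
   it without a factor [1 / n]. *)
have WW : ip P A W W <= mean (fun i => ip P A (a i) (a i)).
  rewrite /mean /ip -Rintegral_sumT//; last first.
    by move=> i; exact: (sqint_dotp (a2 i) (a2 i)).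
  rewrite -RintegralZT//; last first.
    by apply: integrable_sumR => i; exact: (sqint_dotp (a2 i) (a2 i)).
  apply: le_RintegralT => //.
  - exact: (sqint_dotp W2 W2).
  - apply: integrableZR; apply: integrable_sumR => i.
    exact: (sqint_dotp (a2 i) (a2 i)).
  - by move=> w; exact: dotp_average_le.
have : mean (fun i => ip P A (U i) (U i)) <=
    omega * (mean (fun i => ip P A (V i) (V i))
    + 2 * mean (fun i => ip P A (a i) (a i)) + 2 * mean (fun i => ip P A (b i) (b i))).
  rewrite -!meanZ -!meanD -meanZ; apply: le_mean => i.
  by apply: le_trans (ipU_le i JA) _; rewrite ler_wpM2l// ipD_le.
move=> /(ler_wpM2l (ltW nR)) UD.
rewrite -/a -/b; move: UD WW; set x1 := n%:R^-1; lra.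
Qed.

(** Tower property: an event of the past is also an event of [<<s J >>], so over it q_i integrates
    like g_i - h_i, and g_i like F_i(x). The shifts then cancel. *)
Lemma compressed_average_mean :
  is_cond_exp_rV P G (fun w => average (h ^~ w) + average (q ^~ w))
    (fun w => average (Fx ^~ w)).
Proof.
move=> j; have hq2 := sqint_rVD (sqint_rV_average h2) (sqint_rV_average q2).
have F2 := sqint_rV_average Fx2.
apply: (is_cond_expP sG); [exact: sqintW (hq2 j)|exact: sqintW (F2 j)| |].
  have mF : measurable_fun [set: g_sigma_algebraType G] (fun w => average (Fx ^~ w)).
    exact: measurable_average.
  exact: (measurableT_comp (measurable_coord j) mF).
move=> A GA; have mA := gen_measurable sG GA; have JA := sGJ GA.
have avE (u : 'I_n -> T -> 'rV[R]_d) : (forall i, sqint_rV P (u i)) ->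
    \int[P]_(w in A) average (u ^~ w) 0 j = mean (fun i => \int[P]_(w in A) u i w 0 j).
  move=> u2; have ui i := sqintW (u2 i j).
  rewrite /mean -Rintegral_sumT// -RintegralZT//; last exact: integrable_sumR.
  by apply: eq_Rintegral => w _; rewrite mxE summxE.
under eq_Rintegral do rewrite mxE.
rewrite RintegralDT//; [|exact: sqintW (sqint_rV_average h2 j)|
  exact: sqintW (sqint_rV_average q2 j)].
rewrite !avE// -meanD /mean; congr (_ * _); apply: eq_bigr => i _.
rewrite (cond_exp_Rintegral (compressed_mean i j) JA).
under [X in _ + X]eq_Rintegral do rewrite !mxE.
rewrite RintegralBT//; [|exact: sqintW (gi2 i j)|exact: sqintW (h2 i j)].
by rewrite (cond_exp_Rintegral (gi_mean i j) GA); ring.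
Qed.

Variables (alpha : R) (alpha0 : 0 <= alpha) (alpha1 : alpha * (1 + omega) <= 1).

Let h_err i w : 'rV[R]_d := h i w + alpha *: q i w - Fs i.

(** For each worker, with b = h_i - Fs_i, the noise U_i is orthogonal to b and D_i, so the new error
    is at most |b|^2 + 2 alpha <D_i, b> + alpha^2 (1 + omega) |D_i|^2. As alpha (1 + omega) is at
    most 1, this is at most (1 - alpha) |b|^2 + alpha |D_i + b|^2. Finally D_i + b = g_i - Fs_i is
    V_i plus a term orthogonal to it, which keeps the factor 2 of [ipD_le] out of [C] and [D2]. *)
Lemma shift_update_le A : <<s G >> A ->
  n%:R^-1 * \sum_i ip P A (h_err i) (h_err i) <=
    (1 - alpha) * (n%:R^-1 * \sum_i
       ip P A (fun w => h i w - Fs i) (fun w => h i w - Fs i))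
    + alpha * (n%:R^-1 * \sum_i ip P A (V i) (V i)
       + n%:R^-1 * \sum_i
           ip P A (fun w => Fx i w - Fs i) (fun w => Fx i w - Fs i)).
Proof.
move=> GA; have mA := gen_measurable sG GA; have JA := sGJ GA.
rewrite -!/(mean _) -meanD -!meanZ -meanD; apply: le_mean => i.
pose a w := Fx i w - Fs i; pose b w := h i w - Fs i.
have a2 : sqint_rV P a by apply: sqint_rVB => //; exact: sqint_rV_cst.
have b2 : sqint_rV P b by apply: sqint_rVB => //; exact: sqint_rV_cst.
have mb : measurable_fun [set: g_sigma_algebraType J] b.
  by apply: mB; [exact: mGJ|exact: cst_measurable].
have ma : measurable_fun [set: g_sigma_algebraType G] a.
  by apply: mB => //; exact: cst_measurable.
have aD2 := sqint_rVZ alpha (D2 i); have aU2 := sqint_rVZ alpha (U2 i).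
have baD2 := sqint_rVD b2 aD2.
have -> : h_err i = (fun w => b w + alpha *: D i w + alpha *: U i w).
  by apply/funext => w; apply/rowP => j; rewrite /h_err /b /U !mxE; ring.
rewrite ip_sqrD// [X in 2 * X](_ : _ = 0); last first.
  by rewrite ipC ipZl// ipC ipDl// ipZl// !(ipC _ _ _ (U i)) !ipU0// !(mulr0, addr0).
rewrite ip_sqrD// !ipZl// !(ipC _ _ _ (fun w => alpha *: _)) !ipZl//.
have : ip P A (fun w => D i w + b w) (fun w => D i w + b w) =
    ip P A (V i) (V i) + ip P A a a.
  have -> : (fun w => D i w + b w) = (fun w => V i w + a w).
    by apply/funext => w; apply/rowP => j; rewrite /D /V /a /b !mxE; ring.
  by rewrite ip_sqrD// [X in 2 * X]ipV0// mulr0 addr0.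
rewrite ip_sqrD// -/a -/b => VE.
have := ipU_le i JA; have := ip_ge0 P A (D i); rewrite -VE.
set DD := ip P A (D i) (D i); set UU := ip P A (U i) (U i).
set bb := ip P A b b; set Db := ip P A (D i) b.
move=> DD0 UD.
have : alpha * (alpha * UU) <= alpha * (alpha * (omega * DD)).
  by rewrite !ler_wpM2l.
have : alpha * (alpha * (1 + omega) * DD) <= alpha * DD.
  by rewrite ler_wpM2l// ler_piMl.
lra.
Qed.

End compressed_step.

(** * The proximal step *)

Section variational_inequality.
Context {R : realType} {d : nat}.
Implicit Types (reg : 'rV[R]_d -> \bar R) (x y z v : 'rV[R]_d).

Lemma projection_set1 xs x : projection [set xs] x = xs.
Proof.
rewrite /projection; set S := argmin _ _.
have Sxs : S xs by split => // y ->.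
by have [] := xgetI 0 Sxs.
Qed.

(** It replaces the limit t -> 0. The choice t = K / (K + N) is admissible even for N = 0 and turns
    the hypothesis into K (K + N) <= K N, impossible for K > 0. *)
Lemma le0_of_le_scale (K N : R) :
  0 <= N -> (forall t, 0 < t <= 1 -> K <= t * N) -> K <= 0.
Proof.
move=> N0 KN; rewrite leNgt; apply/negP => K0.
have KN0 : 0 < K + N by rewrite ltr_pwDl.
have t01 : 0 < K / (K + N) <= 1.
  by rewrite divr_gt0//= ler_pdivrMr// mul1r lerDl.
have := KN _ t01; rewrite mulrAC ler_pdivlMr//; nra.
Qed.

(** [xs] is the proximal point of [xs - gamma *: F xs], and the right side is the squared distance
    from [v] to that argument. *)
Lemma prox_solution_bound (F : 'rV[R]_d -> 'rV[R]_d) reg gamma xs v z :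
  proper_ereal reg -> convex_ereal reg -> 0 < gamma ->
  rvi_solutions F reg xs -> prox gamma reg v z ->
  dotp (z - xs) (z - xs) <=
    dotp (v - xs + gamma *: F xs) (v - xs + gamma *: F xs).
Proof.
move=> [regNy [x0 regx0]] conv gamma0 sol [_ zmin].
(* If [reg xs] were +oo, the inequality at a point [x0] of finite value would read 0 <= -oo. *)
have [a regxs] : exists a, reg xs = a%:E.
  have := sol x0; have := regNy xs; have := regNy x0; move: regx0.
  case: (reg x0) => // r0 _ _; case: (reg xs) => // a _ _.
  by exists a.
have [b regz] : exists b, reg z = b%:E.
  have := zmin xs I; have := regNy z; rewrite regxs -EFinD.
  by case: (reg z) => // b _ _; exists b.
have := sol z; rewrite regxs regz -EFinD lee_fin => solz.
(* Minimality of [z] is tested on the segment towards [xs], at weight [t]; convexity and division by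
   [t] leave a bound with error [t * N]. The difference of the values of [reg] is eliminated through
   the variational inequality at [z]. *)
pose K := 2 * dotp (z - v) (z - xs) - 2 * gamma * dotp (F xs) (z - xs).
pose N := dotp (z - xs) (z - xs).
have : K <= 0.
  apply: (@le0_of_le_scale _ N (dotp_ge0 _)) => t /andP[t0 t1].
  have t01 : 0 <= t <= 1 by rewrite (ltW t0).
  have := conv t xs z t01; rewrite regxs regz -!EFinM -EFinD.
  have := zmin (t *: xs + (1 - t) *: z) I; rewrite regz -EFinD.
  have := regNy (t *: xs + (1 - t) *: z).
  case: (reg (t *: xs + (1 - t) *: z)) => // c _.
  rewrite -EFinD !lee_fin => zc ct.
  have := le_trans zc (lerD ct (lexx _)).
  rewrite !sqr_norm2.
  have -> : t *: xs + (1 - t) *: z - v = (z - v) - t *: (z - xs).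
    by apply/rowP => j; rewrite !mxE; ring.
  rewrite [dotp (_ - t *: _) _](_ : _ = dotp (z - v) (z - v)
      - 2 * t * dotp (z - v) (z - xs) + t ^+ 2 * N); last first.
    rewrite /N; move: (z - v) (z - xs) => p e.
    by rewrite !dotpE (dotpC e p); ring.
  move=> h.
  have g2 : 0 < 2 * gamma by rewrite mulr_gt0.
  have : (2 * gamma) * (t * (b - a)) <= t * (t * N - 2 * dotp (z - v) (z - xs)).
    rewrite -ler_pdivlMl//.
    move: h; rewrite !(mulrC _ (2 * gamma)^-1); nra.
  rewrite mulrCA ler_pM2l// => h2.
  rewrite /K; nra.
rewrite /K.
(* With e = z - xs and r = v - xs + gamma F(xs), K <= 0 says |e|^2 <= <r, e>; this square turns it
   into |e|^2 <= |r|^2. *)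
have := dotp_ge0 ((z - xs) - (v - xs + gamma *: F xs)).
have -> : z - v = (z - xs) - (v - xs) by rewrite opprB addrA subrK.
move: (z - xs) (v - xs) => e p.
rewrite !dotpE (dotpC p e) (dotpC (F xs) e) (dotpC (F xs) p); lra.
Qed.

End variational_inequality.

Lemma sqint_rV_le dT (T : measurableType dT) (R : realType)
    (P : probability T R) (d e : nat) (c : R) (f : T -> 'rV[R]_d)
    (u : T -> 'rV[R]_e) : measurable_fun setT f -> sqint_rV P u ->
  (forall w, dotp (f w) (f w) <= c * dotp (u w) (u w)) -> sqint_rV P f.
Proof.
move=> /measurable_rVP mf u2 fu j; split => //.
apply: le_integrableR (integrableZR c (sqint_dotp u2 u2)).
  exact: measurable_funX.
by move=> w; rewrite ger0_norm ?sqr_ge0// (le_trans (sqr_coord_le _ j)).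
Qed.

(** Let m be the mean of the |a_i|^2 and W the average. Then 2m <= 2l <W, e> <= |W|^2 + l^2 |e|^2 <=
    m + l^2 |e|^2, the last step by Jensen. Passing from the mean to one index costs the factor
    n. *)
Lemma cocoercive_lipschitz (R : realType) (d n : nat) (a : 'I_n -> 'rV[R]_d)
    (e : 'rV[R]_d) (l : R) (i : 'I_n) : (0 < n)%N ->
  n%:R^-1 * \sum_i dotp (a i) (a i) <= l * dotp (average a) e ->
  dotp (a i) (a i) <= n%:R * l ^+ 2 * dotp e e.
Proof.
move=> n0 coco; have nR : 0 < n%:R :> R by rewrite ltr0n.
have := dotp_average_le a n0; have := dotp_ge0 (average a - l *: e).
have : dotp (a i) (a i) <= \sum_i dotp (a i) (a i).
  by rewrite (bigD1 i)//= lerDl sumr_ge0// => j _; exact: dotp_ge0.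
move: coco; set s := \sum_i _; move: (average a) => W.
rewrite !dotpE (dotpC e W) => coco is_le W_ge W_le.
have : n%:R^-1 * s <= l ^+ 2 * dotp e e by nra.
by rewrite ler_pdivrMl// mulrA => /(le_trans is_le).
Qed.

(** * Integrability along the run and assembly of the two recursions *)

Theorem proposition5p4
    (R : realType) (d n : nat) (n_gt0 : (0 < n)%N)
    (dT : measure_display) (T : measurableType dT) (P : probability T R)
    (Fi : 'I_n -> 'rV[R]_d -> 'rV[R]_d) (F : 'rV[R]_d -> 'rV[R]_d)
    (F_avg : forall x, F x = average (fun i => Fi i x))
    (reg : 'rV[R]_d -> \bar R)
    (reg_proper : proper_ereal reg) (reg_lsc : lower_semicontinuous reg)
    (reg_convex : convex_ereal reg)
    (lhat : R) (lhat_gt0 : 0 < lhat)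
    (Fi_cocoercive : forall x,
       let xs := projection (rvi_solutions F reg) x in
       n%:R^-1 * \sum_(i < n) norm2 (Fi i x - Fi i xs) ^+ 2
         <= lhat * dotp (F x - F xs) (x - xs))
    (xstar : 'rV[R]_d) (solutions : rvi_solutions F reg = [set xstar])
    (omega : R) (omega_ge0 : 0 <= omega)
    (Q : R.-pker ('rV[R]_d) ~> ('rV[R]_d)) (Q_unbiased : unbiased_compressor omega Q)
    (gamma alpha : R) (gamma_gt0 : 0 < gamma)
    (alpha_gt0 : 0 < alpha) (alpha_le : alpha <= 1 / (1 + omega))
    (Fil : nat -> set (set T))
    (x0 : 'rV[R]_d) (h0 : 'I_n -> 'rV[R]_d)
    (x h g : nat -> T -> 'rV[R]_d) (hi gi q : 'I_n -> nat -> T -> 'rV[R]_d)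
    (run : diana_sgda P Fil gamma alpha reg Q x0 h0 x hi h gi q g)
    (sigmai : 'I_n -> R)
    (gi_unbiased : forall i k,
       is_cond_exp_rV P (Fil k) (gi i k) (fun w => Fi i (x k w)))
    (gi_variance : forall i k,
       cond_exp_le P (Fil k) (fun w => norm2 (gi i k w - Fi i (x k w)) ^+ 2)
         (fun=> sigmai i ^+ 2))
    (sigma : nat -> T -> R) (sigma_ge0 : forall k w, 0 <= sigma k w)
    (sigma_sqr : forall k w,
       sigma k w ^+ 2 = n%:R^-1 * \sum_(i < n) norm2 (hi i k w - Fi i xstar) ^+ 2) :
  let sigma2 := n%:R^-1 * \sum_(i < n) sigmai i ^+ 2 in
  key_parametric_assumption P Fil F (rvi_solutions F reg) x g
    ((1 / 2 + omega / n%:R) * lhat)      (* A *)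
    (2 * omega / n%:R)                   (* B *)
    (alpha * lhat / 2)                   (* C *)
    ((1 + omega) * sigma2 / n%:R)        (* D1 *)
    (alpha * sigma2)                     (* D2 *)
    alpha                                (* rho *)
    sigma.
Proof.
move=> sigma2.
have nR : 0 < n%:R^-1 :> R by rewrite invr_gt0 ltr0n.
have omega1 : 0 < 1 + omega by rewrite ltr_pwDl.
have alpha1 : alpha * (1 + omega) <= 1 by rewrite -ler_pdivlMr //.
have alpha_le1 : alpha <= 1.
  have := mulr_ge0 (ltW alpha_gt0) omega_ge0; lra.
have projE y : projection (rvi_solutions F reg) y = xstar.
  by rewrite solutions projection_set1.
pose Fs i := Fi i xstar.
have FsE : F xstar = average Fs by rewrite F_avg.
have coco y : n%:R^-1 * \sum_i dotp (Fi i y - Fs i) (Fi i y - Fs i)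
    <= lhat * dotp (F y - F xstar) (y - xstar).
  have /= := Fi_cocoercive y; rewrite projE.
  by under eq_bigr do rewrite sqr_norm2.
have Fil_measurable k : Fil k `<=` measurable.
  by have [] := diana_filtration run k.
have giad : forall i k,
  measurable_fun [set: g_sigma_algebraType (Fil k.+1)] (gi i k) := diana_gi_adapted run.
have qad : forall i k,
  measurable_fun [set: g_sigma_algebraType (Fil k.+1)] (q i k) := diana_q_adapted run.
have hiad : forall i k,
  measurable_fun [set: g_sigma_algebraType (Fil k)] (hi i k) := diana_hi_adapted run.
have xad : forall k,
  measurable_fun [set: g_sigma_algebraType (Fil k)] (x k) := diana_x_adapted run.
have mgi i k : measurable_fun setT (gi i k).
  exact: (gen_measurable_fun (Fil_measurable k.+1) (giad i k)).
have mq i k : measurable_fun setT (q i k).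
  exact: (gen_measurable_fun (Fil_measurable k.+1) (qad i k)).
have hE k w : h k w = average (fun i => hi i k w).
  elim: k => [|k ih].
    rewrite (diana_h0 run); congr average; apply/funext => i.
    by rewrite (diana_hi0 run).
  rewrite (diana_h run) ih -averageZ -averageD; congr average; apply/funext => i.
  by rewrite (diana_hi run).
have gE k w : g k w = average ((hi ^~ k) ^~ w) + average ((q ^~ k) ^~ w).
  by rewrite (diana_g run) hE.
(* Measurability is read off unbiasedness: F_i(x^k) is a version of a conditional expectation given
   the past. *)
have mFi i k : measurable_fun [set: g_sigma_algebraType (Fil k)] (fun w => Fi i (x k w)).
  by apply/measurable_rVP => j; have [] := gi_unbiased i k j.
have FiT i k : measurable_fun setT (fun w => Fi i (x k w)).
  exact: (gen_measurable_fun (Fil_measurable k) (mFi i k)).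
have Fi2 i k : sqint_rV P (x k) -> sqint_rV P (fun w => Fi i (x k w)).
  move=> x2.
  have xe2 := sqint_rVB x2 (sqint_rV_cst P xstar).
  have Fd2 : sqint_rV P (fun w => Fi i (x k w) - Fs i).
    apply: (sqint_rV_le (c := n%:R * lhat ^+ 2) _ xe2).
      apply/measurable_rVP => j; under eq_fun do rewrite !mxE.
      by apply: measurable_funB => //; have /measurable_rVP := FiT i k.
    move=> w; apply: (@cocoercive_lipschitz _ _ _ (fun i => Fi i (x k w) - Fs i)) => //.
    by rewrite averageB -FsE -F_avg.
  have := sqint_rVD Fd2 (sqint_rV_cst P (Fs i)).
  by under eq_fun do rewrite subrK.
have gi2 i k : sqint_rV P (x k) -> sqint_rV P (gi i k).
  move=> x2; have F2 := Fi2 i k x2.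
  have V2 : sqint_rV P (fun w => gi i k w - Fi i (x k w)).
    (* Integrability of the squared error is part of having a conditional expectation, hence of the
       variance bound. *)
    have [Z [Vi _ _ _] _] := gi_variance i k.
    move=> j; have mV : measurable_fun setT (fun w => (gi i k w - Fi i (x k w)) 0 j).
      under eq_fun do rewrite !mxE; apply: measurable_funB.
        by have /measurable_rVP := mgi i k.
      by have /measurable_rVP := FiT i k.
    split => //; apply: le_integrableR Vi; first exact: measurable_funX.
    by move=> w; rewrite sqr_norm2 ger0_norm ?sqr_ge0// sqr_coord_le.
  have := sqint_rVD V2 F2.
  by under eq_fun do rewrite subrK.
have q2 i k : sqint_rV P (x k) -> (forall i, sqint_rV P (hi i k)) ->
    sqint_rV P (q i k).
  move=> x2 h2.
  exact: (compressed_sqint (Fil_measurable k) h2 (fun i => gi2 i k x2)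
    (fun i => hiad i k) (mq ^~ k) Q_unbiased (fun i => diana_q_law run i k)).
(* The induction is joint: x^{k+1} and the h_i^{k+1} both depend on the compressed vectors, whose
   square integrability needs x^k and all the h_i^k. *)
have xh2 k : sqint_rV P (x k) /\ forall i, sqint_rV P (hi i k).
  elim: k => [|k [x2 h2]].
    split=> [|i j].
      by move=> j; under eq_fun do rewrite (diana_x0 run); exact: sqint_cst.
    by under eq_fun do rewrite (diana_hi0 run); exact: sqint_cst.
  have qk2 i := q2 i k x2 h2.
  split; last first.
    move=> i j; under eq_fun do rewrite (diana_hi run).
    exact: sqint_rVD (h2 i) (sqint_rVZ alpha (qk2 i)) j.
  have g2 : sqint_rV P (g k).
    move=> j; under eq_fun do rewrite gE.
    exact: sqint_rVD (sqint_rV_average h2) (sqint_rV_average qk2) j.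
  have p2 := sqint_rVD (sqint_rVB (sqint_rVB x2 (sqint_rVZ gamma g2))
    (sqint_rV_cst P xstar)) (sqint_rV_cst P (gamma *: F xstar)).
  have d2 : sqint_rV P (fun w => x k.+1 w - xstar).
    apply: (sqint_rV_le (c := 1) _ p2).
      have mx := gen_measurable_fun (Fil_measurable k.+1) (xad k.+1).
      apply/measurable_rVP => j; under eq_fun do rewrite !mxE.
      by apply: measurable_funB => //; have /measurable_rVP := mx.
    move=> w; rewrite mul1r; apply: (prox_solution_bound reg_proper) => //.
      by rewrite solutions.
    exact: diana_x run k w.
  have := sqint_rVD d2 (sqint_rV_cst P xstar).
  by under eq_fun do rewrite subrK.
have sigma2_ge0 : 0 <= sigma2.
  by rewrite mulr_ge0 ?(ltW nR)// sumr_ge0// => i _; rewrite sqr_ge0.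
have omegan0 : 0 <= omega / n%:R by rewrite divr_ge0.
split; last split; last split.
- split.
  + by rewrite mulr_ge0 ?(ltW lhat_gt0)// addr_ge0// divr_ge0.
  + by rewrite -mulrA mulr_ge0.
  + by rewrite divr_ge0// mulr_ge0 ?(ltW lhat_gt0) ?(ltW alpha_gt0).
  + by rewrite divr_ge0// mulr_ge0// ltW.
  + by rewrite mulr_ge0// ltW.
- by rewrite alpha_gt0.
- exact: sigma_ge0.
move=> k xs gs.
have xsE w : xs w = xstar by exact: projE.
have gsE w : gs w = F xstar by rewrite /gs xsE.
have sG := @Fil_measurable k.
have [x2 h2] := xh2 k.
have Fk2 i := Fi2 i k x2; have gk2 i := gi2 i k x2; have qk2 i := q2 i k x2 h2.
pose V i w : 'rV[R]_d := gi i k w - Fi i (x k w).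
pose a i w : 'rV[R]_d := Fi i (x k w) - Fs i.
pose b i w : 'rV[R]_d := hi i k w - Fs i.
pose D w := dotp (F (x k w) - F xstar) (x k w - xstar).
have a2 i : sqint_rV P (a i) by apply: sqint_rVB => //; exact: sqint_rV_cst.
have b2 i : sqint_rV P (b i) by apply: sqint_rVB => //; exact: sqint_rV_cst.
have V2 i : sqint_rV P (V i) by exact: sqint_rVB.
have aE w : average (a ^~ w) = F (x k w) - F xstar by rewrite averageB -FsE -F_avg.
have Di : P.-integrable setT (EFin \o D).
  have := sqint_dotp (sqint_rV_average a2) (sqint_rVB x2 (sqint_rV_cst P xstar)).
  by under eq_fun do rewrite aE.
have Vi i : P.-integrable setT (EFin \o (fun w => dotp (V i w) (V i w))).
  exact: (sqint_dotp (V2 i) (V2 i)).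
have mean_ip A (u : 'I_n -> T -> 'rV[R]_d) : measurable A ->
    (forall i, sqint_rV P (u i)) ->
    n%:R^-1 * \sum_i ip P A (u i) (u i) =
    \int[P]_(w in A) (n%:R^-1 * \sum_i dotp (u i w) (u i w)).
  move=> mA u2.
  have ui i : P.-integrable setT (EFin \o (fun w => dotp (u i w) (u i w))).
    exact: (sqint_dotp (u2 i) (u2 i)).
  by rewrite RintegralZT ?Rintegral_sumT//; exact: integrable_sumR.
have meani (u : 'I_n -> T -> 'rV[R]_d) : (forall i, sqint_rV P (u i)) ->
    P.-integrable setT (EFin \o (fun w => n%:R^-1 * \sum_i dotp (u i w) (u i w))).
  move=> u2; apply: integrableZR; apply: integrable_sumR => i.
  exact: (sqint_dotp (u2 i) (u2 i)).
have sE w : sigma k w ^+ 2 = n%:R^-1 * \sum_i dotp (b i w) (b i w).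
  by rewrite sigma_sqr; under eq_bigr do rewrite sqr_norm2.
have aD A : measurable A ->
    n%:R^-1 * \sum_i ip P A (a i) (a i) <= lhat * \int[P]_(w in A) D w.
  move=> mA; rewrite mean_ip// -RintegralZT//; apply: le_RintegralT => //.
  - exact: meani.
  - exact: integrableZR.
  - by move=> w; exact: coco.
have Vs A : <<s Fil k >> A ->
    n%:R^-1 * \sum_i ip P A (V i) (V i) <= sigma2 * fine (P A).
  move=> GA; have mA := gen_measurable sG GA.
  rewrite /sigma2 -mulrA ler_wpM2l ?(ltW nR)// mulr_suml ler_sum// => i _.
  rewrite -Rintegral_cst//.
  have VE : (fun w => norm2 (gi i k w - Fi i (x k w)) ^+ 2) =
      (fun w => dotp (V i w) (V i w)) by apply/funext => w; rewrite sqr_norm2.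
  have := gi_variance i k; rewrite VE => /(cond_exp_leP sG (Vi i)).
  by apply => //; exact: integrable_cstR.
have mD : measurable_fun [set: g_sigma_algebraType (Fil k)] D.
  apply: measurable_dotp; apply/measurable_rVP => j; under eq_fun do rewrite !mxE;
    apply: measurable_funB => //.
    have := measurable_average (mFi ^~ k) => /measurable_rVP/(_ j).
    by under eq_fun do rewrite -F_avg.
  by have /measurable_rVP := xad k.
have ms : measurable_fun [set: g_sigma_algebraType (Fil k)] (fun w => sigma k w ^+ 2).
  under eq_fun do rewrite sE.
  apply: measurable_funM => //; apply: measurable_sum => i.
  have mb : measurable_fun [set: g_sigma_algebraType (Fil k)] (b i).
    apply/measurable_rVP => j; under eq_fun do rewrite !mxE.
    by apply: measurable_funB => //; have /measurable_rVP := hiad i k.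
  exact: measurable_dotp.
have si : P.-integrable setT (EFin \o (fun w => sigma k w ^+ 2)).
  by under eq_fun do rewrite sE; exact: meani.
(* Both recursions have this right side; over an event [A] of the past, sigma_k^2 integrates to the
   mean of the [ip P A (b i) (b i)] and the constant to a multiple of [P A]. *)
have boundP (c1 c2 c3 : R) (X : T -> R) : P.-integrable setT (EFin \o X) ->
    (forall A, <<s Fil k >> A -> \int[P]_(w in A) X w <=
      c1 * \int[P]_(w in A) D w + c2 * (n%:R^-1 * \sum_i ip P A (b i) (b i))
      + c3 * fine (P A)) ->
    cond_exp_le P (Fil k) X (fun w => c1 * D w + c2 * sigma k w ^+ 2 + c3).
  move=> Xi XB.
  have Y1 := integrableZR c1 Di; have Y2 := integrableZR c2 si.
  have Y12 := integrableDR Y1 Y2; have Y3 := integrable_cstR P c3.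
  apply/(cond_exp_leP sG Xi (integrableDR Y12 Y3)).
    apply: measurable_funD => //; apply: measurable_funD; exact: measurable_funM.
  move=> A GA; have mA := gen_measurable sG GA.
  rewrite !RintegralDT// !RintegralZT// Rintegral_cst//.
  rewrite (eq_Rintegral _ (fun w _ => sE w)) -mean_ip//.
  exact: XB.
split.
- move=> j.
  have := compressed_average_mean sG h2 Fk2 gk2 (fun i => hiad i k) (mq ^~ k)
    (fun i => gi_unbiased i k) Q_unbiased (fun i => diana_q_law run i k) j.
  under eq_fun do rewrite -gE.
  by under [X in is_cond_exp _ _ _ X]eq_fun do rewrite -F_avg.
- pose e w : 'rV[R]_d :=
    average ((hi ^~ k) ^~ w) + average ((q ^~ k) ^~ w) - average Fs.
  have e2 : sqint_rV P e.
    apply: sqint_rVB; last exact: sqint_rV_cst.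
    by apply: sqint_rVD; exact: sqint_rV_average.
  rewrite (_ : (fun w => norm2 _ ^+ 2) = (fun w => dotp (e w) (e w))); last first.
    by apply/funext => w; rewrite sqr_norm2 gE gsE FsE.
  under [X in cond_exp_le _ _ _ X]eq_fun do rewrite gsE xsE.
  apply: boundP => [|A GA]; first exact: (sqint_dotp e2 e2).
  apply: le_trans (compressed_average_le sG Fs h2 Fk2 gk2 (fun i => hiad i k)
    (mq ^~ k) (fun i => gi_unbiased i k) (diana_gi_indep run k) omega_ge0 Q_unbiased
    (fun i => diana_q_law run i k) (diana_q_indep run k) n_gt0 GA) _.
  have mA := gen_measurable sG GA; have := aD A mA; have := Vs A GA.
  rewrite -/(a _) -/(b _) -/(V _).
  set SV := n%:R^-1 * _; set Sa := n%:R^-1 * \sum_i ip P A (a i) (a i).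
  set Sb := n%:R^-1 * \sum_i ip P A (b i) (b i) => VsA aDA.
  (* The products with [n%:R^-1] and [omega] are formed beforehand, so that what remains is linear
     in its monomials. *)
  have VsA' : n%:R^-1 * ((1 + omega) * SV) <=
      n%:R^-1 * ((1 + omega) * (sigma2 * fine (P A))).
    by rewrite !ler_wpM2l// ltW.
  have aDA' : n%:R^-1 * (omega * Sa) <=
      n%:R^-1 * (omega * (lhat * \int[P]_(w in A) D w)).
    by rewrite !ler_wpM2l// ltW.
  rewrite -/Sa -/Sb -/SV; lra.
- have s1E w : sigma k.+1 w ^+ 2 = n%:R^-1 * \sum_i
      dotp (hi i k w + alpha *: q i k w - Fs i) (hi i k w + alpha *: q i k w - Fs i).
    rewrite sigma_sqr; congr (_ * _); apply: eq_bigr => i _.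
    by rewrite sqr_norm2 (diana_hi run).
  under eq_fun do rewrite s1E.
  under [X in cond_exp_le _ _ _ X]eq_fun do rewrite gsE xsE.
  have e2 i : sqint_rV P (fun w => hi i k w + alpha *: q i k w - Fs i).
    apply: sqint_rVB; last exact: sqint_rV_cst.
    by apply: sqint_rVD => //; exact: sqint_rVZ.
  apply: boundP => [|A GA]; first exact: meani.
  have mA := gen_measurable sG GA; rewrite -(mean_ip A) //.
  apply: le_trans (shift_update_le sG Fs h2 Fk2 gk2 (fun i => hiad i k)
    (mq ^~ k) (fun i => gi_unbiased i k) Q_unbiased
    (fun i => diana_q_law run i k) n_gt0 (ltW alpha_gt0) alpha1 GA) _.
  have := aD A mA; have := Vs A GA.
  set SV := n%:R^-1 * _; set Sa := n%:R^-1 * \sum_i ip P A (a i) (a i).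
  set Sb := n%:R^-1 * \sum_i ip P A (b i) (b i).
  rewrite -/Sa -/Sb -/SV => /(ler_wpM2l (ltW alpha_gt0)) VsA.
  move=> /(ler_wpM2l (ltW alpha_gt0)) aDA; lra.
Qed.
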